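(* Every 3-connected graph of order at least $6$ contains two cycles of consecutive even lengths.
   Context: All graphs are finite, undirected and simple; the order of a graph is its number of vertices. Two cycles have consecutive even lengths if their lengths are $2m$ and $2m+2$ for some integer $m\ge 2$. *)

(* Defs.v *)
From mathcomp Require Import all_boot.

Set Implicit Arguments.
Unset Strict Implicit.
Unset Printing Implicit Defensive.

(* A finite simple graph is a symmetric irreflexive adjacency
   relation [e] on a finType [T] of vertices, so its order is [#|T|]. *)

Definition connected_on (T : finType) (e : rel T) (A : {set T}) : Prop :=
  A != set0 /\ {in A &, forall x y, connect [rel u v in A | e u v] x y}.

Definition k_connected (k : nat) (T : finType) (e : rel T) : Prop :=
  k < #|T| /\ forall S : {set T}, #|S| < k -> connected_on e (~: S).

(* The bound [2 < n] is needed because [ucycle] also accepts the empty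
   sequence and, for symmetric [e], a single edge [:: x; y]. *)
Definition has_cycle_of_length (T : finType) (e : rel T) (n : nat) : Prop :=
  2 < n /\ exists c : seq T, ucycle e c /\ size c = n.

(* Main.v *)
Require Import Defs.
From mathcomp Require Import all_boot.
From mathcomp Require Import zify.
From Stdlib Require Import Classical.

(* Suppose there are no two cycles of consecutive even lengths.  First, among all
   pairs of an even cycle D and a connected set H disjoint from D (and containing
   a prescribed connected set), take one with H largest.  By parity, any other
   component of G - D, or a second chord of D, would produce another even cycle
   leaving more room for H; so G = H + D and D has at most one chord unless it is
   a 4-cycle.  Two vertices of D at distance s - 1, where |D| = 2s, split D into
   arcs whose lengths differ by 2, so all paths through H joining them have the
   same parity as s.  If s is odd this contradicts a 2-colouring of a spanning
   tree of H.  If s is even, it forces every odd cycle of H to be separated from D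
   by at most two vertices.  Hence every even cycle meets every odd cycle, and G
   has an odd cycle.

   Now let Z be a shortest odd cycle.  All cycles of G - Z are odd.  If there is
   one, say W, then G = Z + W, because any further component would be attached to
   each of Z and W at a single vertex.  Otherwise G - Z is a forest, whose leaves
   have two neighbours on Z.  In both cases the minimality of Z restricts the arcs
   of Z between attachments so much that two consecutive even lengths appear. *)

Set Implicit Arguments.
Unset Strict Implicit.
Unset Printing Implicit Defensive.

(* [lia] would also case-split on the non-arithmetic booleans of the context. *)
Ltac nat_lia :=
  repeat match goal with
  | H : ?P |- _ => lazymatch P with
    | nat => fail
    | @eq nat _ _ => fail
    | is_true (_ <= _) => fail
    | is_true (_ <= _ <= _) => fail
    | is_true (odd _) => fail
    | is_true (~~ odd _) => fail
    | is_true (_ != _) => fail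
    | @eq bool (odd _) _ => fail
    | _ => clear H
    end
  end; lia.

(** 3-connectivity enters only as [has_no_2cut]: a nonempty set that does not exhaust the graph
    together with its neighbours has at least three of them. The obstacle is that nothing is known
    about path lengths inside [H]. For even [s] a colouring alone gives no contradiction, as it may
    be constant on the neighbours of the even cycle. So [H] is made to contain a prescribed odd
    cycle, enlarged to a maximal set [B] whose vertices are pairwise joined inside it by paths of
    both parities. A connected piece of [H - B] hangs on [B] at one vertex at most, so an edge from
    the even cycle into [H] leads to a vertex of [B], its projection. Vertices at distance [s - 1]
    with different projections would be joined through [H] by paths of both parities, so projections
    hardly vary. The bound 6 excludes [K_5], whose only even cycle length is 4. It is spent on
    neighbourhoods of small sets and on the three vertices outside a shortest odd cycle that is a
    triangle. *)

Lemma ex_max (P : nat -> Prop) M : (exists n, P n) -> (forall n, P n -> n <= M) ->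
  exists n, P n /\ forall m, P m -> m <= n.
Proof.
move=> [n Pn] bnd; have [k] := ubnP (M - n); elim: k n Pn => // k IH n Pn lt.
have [[m [Pm nm]]|no] := classic (exists m, P m /\ n < m).
  by apply: (IH m Pm); have := bnd m Pm; lia.
exists n; split=> // m Pm; rewrite leqNgt; apply/negP => nm; apply: no.
by exists m.
Qed.

Lemma ex_min (P : nat -> Prop) : (exists n, P n) ->
  exists n, P n /\ forall m, P m -> n <= m.
Proof.
move=> [n Pn]; have [k] := ubnP n; elim: k n Pn => // k IH n Pn lt.
have [[m [Pm mn]]|no] := classic (exists m, P m /\ m < n).
  by apply: (IH m Pm); lia.
exists n; split=> // m Pm; rewrite leqNgt; apply/negP => nm; apply: no.
by exists m.
Qed.

Lemma exists_largest_set (T : finType) (P : {set T} -> Prop) : (exists A, P A) ->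
  exists2 A, P A & forall B, P B -> #|B| <= #|A|.
Proof.
move=> [A PA]; have [] := @ex_max (fun n => exists2 A, P A & #|A| = n) #|T|.
- by exists #|A|; exists A.
- by move=> n [B _ <-]; apply: max_card.
by move=> n [[B PB <-] h]; exists B => // C PC; apply: h; exists C.
Qed.

Lemma disjoint_setUl (T : finType) (A B C : {set T}) :
  [disjoint A :|: B & C] = [disjoint A & C] && [disjoint B & C].
Proof. by rewrite !disjoints_subset subUset. Qed.

Lemma disjoint_setU1r (T : finType) (A B : {set T}) x :
  [disjoint A & x |: B] = (x \notin A) && [disjoint A & B].
Proof. by rewrite disjoint_sym disjoint_setUl disjoints1 disjoint_sym. Qed.

Lemma card_gt2_avoid (T : finType) (S : {set T}) x y : 2 < #|S| ->
  exists2 u, u \in S & u != x /\ u != y.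
Proof.
rewrite (cardsD1 x) (cardsD1 y (S :\ x)) => h.
have /card_gt0P[u] : 0 < #|S :\ x :\ y| by move: h; do 2!case: (_ \in _); lia.
by rewrite !inE => /and3P[uy ux uS]; exists u.
Qed.

(** * Paths, cycles and connected sets *)

Section PathsAndCycles.

Variables (T : finType) (e : rel T).
Hypothesis e_sym : symmetric e.

Implicit Types (A B K : {set T}).

Definition lpath (A : {set T}) (x y : T) (n : nat) : Prop :=
  exists p, [/\ path e x p, last x p = y, uniq (x :: p), size p = n
              & {subset x :: p <= A}].

Definition hascyc (A : {set T}) (n : nat) : Prop :=
  2 < n /\ exists c, [/\ ucycle e c, size c = n & {subset c <= A}].

Definition conn (A : {set T}) : Prop :=
  {in A &, forall x y, exists n, lpath A x y n}.

(* Cyclic sequences of vertices are [n]-periodic functions on [nat], so that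
   arcs may wrap around. *)
Definition is_cyc (n : nat) (v : nat -> T) : Prop :=
  [/\ 2 < n, forall i, e (v i) (v i.+1), forall i, v (i + n) = v i
    & forall i j, i < n -> j < n -> v i = v j -> i = j].

(** An arc with [d] edges, hence [d + 1] vertices. *)
Definition arc_set (v : nat -> T) (i d : nat) : {set T} :=
  [set x | [exists k : 'I_d.+1, x == v (i + k)]].

Lemma arc_setP (v : nat -> T) i d x :
  reflect (exists2 k, k <= d & x = v (i + k)) (x \in arc_set v i d).
Proof.
rewrite inE; apply: (iffP existsP) => [[k /eqP ->]|[k lekd ->]].
  by exists k => //; rewrite -ltnS.
by exists (Ordinal (lekd : k < d.+1)); apply/eqP.
Qed.

Lemma lpath_sub A B x y n : lpath A x y n -> A \subset B -> lpath B x y n.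
Proof.
move=> [p [? ? ? ? sA]] /subsetP sAB; exists p; split=> // z /sA; exact: sAB.
Qed.

Lemma hascyc_sub A B n : hascyc A n -> A \subset B -> hascyc B n.
Proof.
move=> [? [c [? ? sA]]] /subsetP sAB; split=> //; exists c; split=> // z /sA.
exact: sAB.
Qed.

Lemma lpath1 A x : x \in A -> lpath A x x 0.
Proof. by move=> xA; exists [::]; split=> // z; rewrite inE => /eqP ->. Qed.

Lemma lpath_ends A x y n : lpath A x y n -> x \in A /\ y \in A.
Proof.
move=> [p [_ <- _ _ sA]]; split; apply: sA; rewrite ?mem_head //.
exact: mem_last.
Qed.

Lemma lpath_eq0 A x y : lpath A x y 0 -> x = y.
Proof. by move=> [[|a p] [_ <- _]]. Qed.

Lemma lpath_cat A B a b x y n m : lpath A a b n -> lpath B x y m ->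
  [disjoint A & B] -> e b x -> lpath (A :|: B) a y (n + m).+1.
Proof.
move=> [p [pp lp up sp sA]] [q [pq lq uq sq sB]] dAB ebx.
exists (p ++ x :: q); split.
- by rewrite cat_path pp lp /= ebx.
- by rewrite last_cat.
- rewrite -cat_cons cat_uniq up uq andbT andTb.
  apply/hasPn => z /sB zB; apply/negP => /sA zA.
  by rewrite (disjointFr dAB zA) in zB.
- by rewrite size_cat /= addnS sp sq.
- move=> z; rewrite -cat_cons mem_cat in_setU => /orP[/sA ->|/sB ->] //.
  exact: orbT.
Qed.

Lemma lpath_join A B a b y n m : lpath A a b n -> lpath B b y m ->
  (forall z, z \in A -> z \in B -> z = b) -> lpath (A :|: B) a y (n + m).
Proof.
move=> [p [pp lp up sp sA]] [q [pq lq uq sq sB]] dAB.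
exists (p ++ q); split.
- by rewrite cat_path pp lp.
- by rewrite last_cat lp.
- have [bq uq'] : b \notin q /\ uniq q by apply/andP.
  rewrite -cat_cons cat_uniq up uq' andbT andTb.
  apply/hasPn => z zq; apply/negP => /sA zA.
  have zB : z \in B by apply: sB; rewrite inE zq orbT.
  by move: bq; rewrite -(dAB z zA zB) zq.
- by rewrite size_cat sp sq.
- move=> z; rewrite -cat_cons mem_cat in_setU => /orP[/sA ->//|zq].
  by rewrite sB ?orbT // inE zq orbT.
Qed.

Lemma lpath_glue A B a b x y n m : lpath A a b n -> lpath B x y m ->
  [disjoint A & B] -> e b x -> e y a -> 0 < n + m ->
  hascyc (A :|: B) (n + m).+2.
Proof.
move=> hA hB dAB ebx eya nm; split; first by lia.
have [p [pp lp up sp sA]] := lpath_cat hA hB dAB ebx.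
exists (a :: p); split=> //=; last by rewrite sp.
by rewrite /ucycle up andbT /= rcons_path pp lp.
Qed.

Lemma lpath_rev A x y n : lpath A x y n -> lpath A y x n.
Proof.
move=> [p [pp lp up sp sA]]; exists (rev (belast x p)).
have E : y :: rev (belast x p) = rev (x :: p).
  by rewrite (lastI x p) rev_rcons lp.
split.
- have := rev_path e x p; rewrite lp => ->.
  by rewrite (eq_path (e' := e)).
- case: p lp {pp up sp sA E} => //= a p _.
  by rewrite rev_cons last_rcons.
- by rewrite E rev_uniq.
- by rewrite size_rev size_belast.
- by move=> z; rewrite E mem_rev; apply: sA.
Qed.

Lemma lpath_close A x y n : lpath A x y n -> e y x -> 1 < n -> hascyc A n.+1.
Proof.
move=> [p [pp lp up sp sA]] eyx n1; split=> //; exists (x :: p).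
by split; rewrite /= ?sp // /ucycle up andbT /= rcons_path pp lp.
Qed.

Lemma lpath_walk A x p : path e x p -> {subset x :: p <= A} ->
  exists n, lpath A x (last x p) n.
Proof.
move=> pp sA; case/shortenP: pp => q pq uq sq.
exists (size q); exists q; split=> // z; rewrite inE => /predU1P[->|/sq zq].
  exact/sA/mem_head.
by apply: sA; rewrite inE zq orbT.
Qed.

Lemma lpath_trans A x y z n m :
  lpath A x y n -> lpath A y z m -> exists k, lpath A x z k.
Proof.
move=> [p [pp lp _ _ sp]] [q [pq lq _ _ sq]].
have [] := @lpath_walk A x (p ++ q).
- by rewrite cat_path pp lp.
- move=> w; rewrite -cat_cons mem_cat => /orP[/sp //|wq].
  by apply: sq; rewrite inE wq orbT.
by rewrite last_cat lp lq => k hk; exists k.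
Qed.

Lemma lpath_edge A x y : x \in A -> y \in A -> e x y -> x != y ->
  lpath A x y 1.
Proof.
move=> xA yA exy nxy; exists [:: y]; split=> //=; rewrite ?exy //.
  by rewrite inE nxy.
by move=> z; rewrite !inE => /orP[] /eqP ->.
Qed.

Lemma lpath_arc (u : nat -> T) i d :
  (forall k, k < d -> e (u (i + k)) (u (i + k).+1)) ->
  (forall k l, k <= d -> l <= d -> u (i + k) = u (i + l) -> k = l) ->
  lpath (arc_set u i d) (u i) (u (i + d)) d.
Proof.
elim: d => [|d IH] he hu.
  by rewrite addn0; apply: lpath1; apply/arc_setP; exists 0; rewrite ?addn0.
have h1 : lpath (arc_set u i d) (u i) (u (i + d)) d.
  apply: IH => [k kd|k l kd ld]; first by apply: he; lia.
  by apply: hu; lia.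
have h2 : lpath [set u (i + d.+1)] (u (i + d.+1)) (u (i + d.+1)) 0.
  by apply: lpath1; rewrite inE.
have dis : [disjoint arc_set u i d & [set u (i + d.+1)]].
  rewrite disjoint_sym disjoints1; apply/arc_setP => -[k kd /hu]; lia.
have := lpath_cat h1 h2 dis; rewrite addn0 addnS => h.
apply: lpath_sub; first by apply: h; apply: he.
apply/subsetP=> x; rewrite inE => /orP[/arc_setP[k kd ->]|].
  by apply/arc_setP; exists k => //; lia.
by rewrite inE => /eqP ->; apply/arc_setP; exists d.+1; rewrite ?addnS.
Qed.

Lemma lpath_fun A x y n : lpath A x y n ->
  exists u : nat -> T, [/\ u 0 = x, u n = y, forall k, k < n -> e (u k) (u k.+1),
    forall k l, k <= n -> l <= n -> u k = u l -> k = l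
  & forall k, k <= n -> u k \in A].
Proof.
move=> [p [pp lp up sp sA]]; exists (fun k => nth x (x :: p) k); split=> //.
- by rewrite -lp -sp (last_nth x).
- by move=> k kn; apply: (pathP x pp); rewrite sp.
- move=> k l kn ln /eqP; rewrite nth_uniq //= ?sp //.
  by move/eqP.
- by move=> k kn; apply: sA; rewrite mem_nth //= sp.
Qed.

Lemma cyc_mod n v i : is_cyc n v -> v (i %% n) = v i.
Proof.
move=> [n2 _ per _]; rewrite [in RHS](divn_eq i n) addnC.
by elim: (i %/ n) => [|k IH]; rewrite ?addn0 // mulSn addnCA addnC per.
Qed.

Lemma cyc_inj n v i j : is_cyc n v -> v i = v j -> i = j %[mod n].
Proof.
move=> hv; rewrite -(cyc_mod i hv) -(cyc_mod j hv); case: hv => n2 _ _ inj.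
by apply: inj; rewrite ltn_mod; lia.
Qed.

Lemma cyc_shift n v k : is_cyc n v -> is_cyc n (fun i => v (k + i)).
Proof.
move=> hv; have [n2 he per _] := hv; split=> //.
- by move=> i; rewrite addnS.
- by move=> i; rewrite addnA per.
move=> i j ni nj /(cyc_inj hv) /eqP; rewrite eqn_modDl => /eqP.
by rewrite !modn_small.
Qed.

Lemma cyc_edge_mod n v i j : is_cyc n v -> j = i.+1 %[mod n] -> e (v i) (v j).
Proof.
move=> hv E; rewrite -(cyc_mod j hv) E (cyc_mod _ hv); by case: hv.
Qed.

Lemma cyc_arc n v i d : is_cyc n v -> d < n ->
  lpath (arc_set v i d) (v i) (v (i + d)) d.
Proof.
move=> hv dn; have [n2 he per _] := hv; apply: lpath_arc => // k l kd ld.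
move/(cyc_inj hv)/eqP; rewrite eqn_modDl => /eqP; rewrite !modn_small; lia.
Qed.

Lemma hascyc_fun A n : hascyc A n <-> exists2 v, is_cyc n v & forall i, v i \in A.
Proof.
split=> [[n2 [c [uc sc sA]]]|[v hv vA]].
  case: c uc sc sA => [|x c] uc sc sA; first by move: n2; rewrite -sc.
  have nn : forall i, i %% n < size (x :: c) by move=> i; rewrite sc ltn_mod; lia.
  exists (fun i => nth x (x :: c) (i %% n)); last first.
    by move=> i; apply/sA/mem_nth.
  have [pc up] := andP uc.
  split=> //.
  - move=> i; move: pc; rewrite /= => /(pathP x) /(_ (i %% n)).
    rewrite size_rcons; move: (nn i) => /= hi /(_ hi).
    rewrite -rcons_cons nth_rcons /= hi nth_rcons.
    have -> : i.+1 %% n = (i %% n).+1 %% n by rewrite -addn1 -modnDml addn1.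
    case: (ltnP (i %% n) (size c)) => h.
      have hs : (i %% n).+1 < n by rewrite -[X in _ < X]sc /= ltnS.
      by rewrite (modn_small hs).
    have -> : i %% n = size c by apply/eqP; rewrite eqn_leq h andbT.
    by rewrite eqxx; move: sc => /= ->; rewrite modnn.
  - by move=> i; rewrite modnDr.
  - move=> i j ni nj /eqP; rewrite !modn_small // nth_uniq ?sc //.
    by move/eqP.
have [n2 he per inj] := hv; split=> //.
have [p [pp lp up sp sp']] := @cyc_arc n v 0 n.-1 hv ltac:(lia).
exists (v 0 :: p); split.
- rewrite /ucycle up andbT /= rcons_path pp lp add0n.
  have := he n.-1; rewrite prednK; last by lia.
  by have := per 0; rewrite !add0n => ->.
- by rewrite /= sp; lia.
- by move=> z /sp' /arc_setP[k _ ->].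
Qed.

Lemma arc_set_disjoint n v i d j d' : is_cyc n v -> i + d < j -> j + d' < i + n ->
  [disjoint arc_set v i d & arc_set v j d'].
Proof.
move=> hv h1 h2; rewrite disjoint_subset; apply/subsetP=> x /arc_setP[k kd ->].
rewrite inE; apply/arc_setP => -[l ld /(cyc_inj hv) /eqP].
have -> : j + l = i + (j - i + l) by lia.
by rewrite eqn_modDl => /eqP; rewrite !modn_small; lia.
Qed.

Lemma arc_set_sub v A i d : (forall i, v i \in A) -> arc_set v i d \subset A.
Proof. by move=> vA; apply/subsetP => x /arc_setP[k _ ->]. Qed.

Definition cset n (v : nat -> T) : {set T} := arc_set v 0 n.-1.

Lemma csetP n v x : is_cyc n v -> reflect (exists2 i, i < n & x = v i) (x \in cset n v).
Proof.
move=> [n2 _ _ _]; apply: (iffP (arc_setP _ _ _ _)) => -[k kn ->]; exists k => //; lia.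
Qed.

Lemma mem_cset n v i : is_cyc n v -> v i \in cset n v.
Proof.
move=> hv; apply/(csetP _ hv); exists (i %% n); last by rewrite (cyc_mod _ hv).
by have [n2 _ _ _] := hv; rewrite ltn_mod; lia.
Qed.

Lemma cset_shift n v k : is_cyc n v -> cset n (fun i => v (k + i)) = cset n v.
Proof.
move=> hv; have hk := cyc_shift k hv; apply/setP => x; apply/idP/idP.
  by case/(csetP _ hk) => i _ ->; apply: mem_cset.
case/(csetP _ hv) => i ni ->.
have [n2 _ _ _] := hv.
have -> : v i = v (k + (i + (n - k %% n))).
  rewrite -(cyc_mod (k + _) hv) -(cyc_mod i hv); congr v.
  have kn : k %% n < n by rewrite ltn_mod; lia.
  rewrite addnCA {1}(divn_eq k n) -addnA subnKC ?(ltnW kn) //.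
  by rewrite -modnDmr modnMDl modnn addn0.
exact: (@mem_cset n (fun i => v (k + i)) _ hk).
Qed.

(** A cycle and a path outside it form a theta graph. This is its cycle through the arc of length
    [d]; [theta_compl] gives the one through the other arc. The condition [0 < d + p] rules out a
    single edge traversed twice. *)
Lemma theta n z A x y i d p : is_cyc n z -> lpath A x y p ->
  [disjoint cset n z & A] -> e (z i) x -> e (z (i + d)) y ->
  d < n -> 0 < d + p -> hascyc (arc_set z i d :|: A) (d + p).+2.
Proof.
move=> hz hA dis ex ey dn dp.
apply: (lpath_glue (cyc_arc i hz dn) (lpath_rev hA)) => //.
  by apply: disjointWl dis; apply: arc_set_sub => k; apply: mem_cset.
by rewrite e_sym.
Qed.

Lemma theta_compl n z A x y i d p : is_cyc n z -> lpath A x y p ->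
  [disjoint cset n z & A] -> e (z i) x -> e (z (i + d)) y ->
  0 < d <= n -> 0 < n - d + p -> hascyc (arc_set z (i + d) (n - d) :|: A) (n - d + p).+2.
Proof.
move=> hz hA dis ex ey dn dp.
apply: (theta hz (lpath_rev hA)) => //; last by lia.
have -> : i + d + (n - d) = i + n by lia.
by have [_ _ -> _] := hz.
Qed.

Lemma conn1 x : conn [set x].
Proof.
by move=> a b; rewrite !inE => /eqP -> /eqP ->; exists 0; apply: lpath1; rewrite inE.
Qed.

Lemma connU A B z : conn A -> conn B -> z \in A -> z \in B -> conn (A :|: B).
Proof.
move=> cA cB zA zB.
have H x : x \in A :|: B -> exists n, lpath (A :|: B) x z n.
  rewrite inE => /orP[xA|xB].
    by have [n h] := cA _ _ xA zA; exists n; apply: lpath_sub h (subsetUl _ _).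
  by have [n h] := cB _ _ xB zB; exists n; apply: lpath_sub h (subsetUr _ _).
move=> x y /H[n hx] /H[m hy]; exact: lpath_trans hx (lpath_rev hy).
Qed.

Lemma conn_add A u w : conn A -> u \in A -> e u w -> conn (w |: A).
Proof.
move=> cA uA euw; have [<-|nuw] := eqVneq u w.
  by rewrite setUC (setUidPl _) // sub1set.
have c2 : conn [set u; w].
  have h1 : lpath [set u; w] u w 1 by apply: lpath_edge; rewrite ?inE ?eqxx ?orbT.
  have hu : lpath [set u; w] u u 0 by apply: lpath1; rewrite !inE eqxx.
  have hw : lpath [set u; w] w w 0 by apply: lpath1; rewrite !inE eqxx orbT.
  move=> a b; rewrite !inE => /orP[]/eqP-> /orP[]/eqP->; eexists;
    [exact: hu|exact: h1|exact: (lpath_rev h1)|exact: hw].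
have -> : w |: A = A :|: [set u; w].
  apply/setP=> a; rewrite !inE orbC; have [->|_] := eqVneq a u; rewrite ?uA ?orbT //.
by apply: (@connU _ _ u) => //; rewrite !inE eqxx.
Qed.

Lemma conn_cset n v : is_cyc n v -> conn (cset n v).
Proof.
move=> hv.
have H x : x \in cset n v -> exists k, lpath (cset n v) (v 0) x k.
  case/(csetP _ hv)=> i ni ->; exists i.
  apply: lpath_sub (cyc_arc 0 hv ni) _.
  by apply: arc_set_sub => k; apply: mem_cset.
by move=> x y /H[n1 h1] /H[n2 h2]; apply: lpath_trans (lpath_rev h1) h2.
Qed.

Lemma path_exit (A B : {set T}) x y n : lpath A x y n -> x \in B -> y \notin B ->
  exists a b, [/\ a \in B, b \notin B, a \in A, b \in A & e a b].
Proof.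
move=> [p [pp lp _ _ sA]]; elim: p x pp lp sA => [|z p IH] x /=.
  by move=> _ -> _ ->.
case/andP=> exz pp lp sA xB yB.
have xA : x \in A by apply: sA; rewrite mem_head.
have zA : z \in A by apply: sA; rewrite !inE eqxx orbT.
have [zB|zB] := boolP (z \in B); last by exists x, z.
by apply: (IH z pp lp) => // a ap; apply: sA; rewrite inE ap orbT.
Qed.

Lemma component_ex (A : {set T}) w : w \in A -> exists K : {set T},
  [/\ K \subset A, conn K, w \in K
    & forall x y, x \in K -> y \in A -> e x y -> y \in K].
Proof.
move=> wA.
have [] := @exists_largest_set _ (fun K => [/\ K \subset A, conn K & w \in K]).
  by exists [set w]; split; rewrite ?sub1set ?inE //; apply: conn1.
move=> K [KA cK wK] mx; exists K; split=> // x y xK yA exy.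
apply/negPn/negP => yK; have := mx (y |: K); rewrite cardsU1 yK => h.
suff : 1 + #|K| <= #|K| by rewrite ltnn.
by apply: h; split; rewrite ?subUset ?sub1set ?yA // ?inE ?wK ?orbT //; apply: conn_add exy.
Qed.

(* The two-colouring of a spanning tree. *)
Lemma conn_color A : conn A -> exists f : T -> bool,
  {in A &, forall x y, exists n, lpath A x y n /\ odd n = f x (+) f y}.
Proof.
move=> cA; have [->|[x0 x0A]] := set_0Vmem A.
  by exists xpred0 => x y; rewrite inE.
pose good (B : {set T}) := [/\ B \subset A, x0 \in B & exists f : T -> bool,
  {in B &, forall x y, exists n, lpath B x y n /\ odd n = f x (+) f y}].
have [|B [BA x0B [f hf]] mx] := @exists_largest_set _ good.
  exists [set x0]; split; rewrite ?sub1set ?inE //; exists xpred0 => x y.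
  rewrite !inE => /eqP-> /eqP->; exists 0; split=> //; apply: lpath1.
  by rewrite inE.
exists f; suff -> : A = B by [].
apply/eqP; rewrite eqEsubset BA andbT; apply/subsetP=> y yA.
apply/negPn/negP=> yB; have [n h] := cA _ _ x0A yA.
have [a [b [aB bB _ bA eab]]] := path_exit h x0B yB.
have := mx (b |: B); rewrite cardsU1 bB => hc.
suff : 1 + #|B| <= #|B| by rewrite ltnn.
apply: hc; split; rewrite ?subUset ?sub1set ?bA // ?inE ?x0B ?orbT //.
exists (fun z => if z == b then ~~ f a else f z).
have hb : forall x, x \in B -> exists n, lpath (b |: B) x b n /\
    odd n = f x (+) ~~ f a.
  move=> x xB; have [m [hm om]] := hf _ _ xB aB; exists m.+1; split.
    have := @lpath_cat B [set b] x a b b m 0 hm.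
    rewrite addn0 setUC; apply=> //; first by apply: lpath1; rewrite inE.
    by rewrite disjoint_sym disjoints1.
  by rewrite /= om; case: (f x); case: (f a).
move=> x z; rewrite !inE.
have nb w : w \in B -> (w == b) = false by apply: contraTF => /eqP ->.
case/predU1P=> [->|xB] /predU1P[->|zB]; rewrite ?eqxx ?nb //.
- by exists 0; rewrite addbb; split=> //; apply: lpath1; rewrite !inE eqxx.
- have [m [hm om]] := hb z zB; exists m; split; first exact: lpath_rev.
  by rewrite om addbC.
- exact: hb.
- have [m [hm om]] := hf _ _ xB zB; exists m; split=> //.
  exact: lpath_sub hm (subsetUr _ _).
Qed.

End PathsAndCycles.

(** * Neighbourhoods and cuts of two vertices *)

Definition nbrs (T : finType) (e : rel T) (X : {set T}) : {set T} :=
  [set y | (y \notin X) && [exists x in X, e x y]].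

Lemma nbrsP (T : finType) (e : rel T) (X : {set T}) y :
  reflect (y \notin X /\ exists2 x, x \in X & e x y) (y \in nbrs e X).
Proof.
rewrite inE; apply: (iffP andP) => -[yX].
  by case/exists_inP=> x xX exy; split=> //; exists x.
by case=> x xX exy; split=> //; apply/exists_inP; exists x.
Qed.

Lemma card_cset (T : finType) (e : rel T) n v : is_cyc e n v -> #|cset n v| = n.
Proof.
move=> hv; have [n2 _ _ inj] := hv.
have -> : cset n v = [set v i | i : 'I_n].
  apply/setP=> x; apply/(csetP _ hv)/imsetP => [[i ni ->]|[i _ ->]].
    by exists (Ordinal ni).
  by exists i.
rewrite card_imset ?card_ord // => i j /inj; move/(_ (ltn_ord i) (ltn_ord j)).
exact: val_inj.
Qed.

Definition has_consecutive_even_cycles (T : finType) (e : rel T) : Prop :=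
  exists n, [/\ ~~ odd n, hascyc e setT n & hascyc e setT n.+2].

(** Phrased by one side [X] only, so that it applies directly to a piece whose neighbours have been
    located. *)
Definition has_no_2cut (T : finType) (e : rel T) : Prop :=
  forall X : {set T}, X != set0 -> #|nbrs e X| <= 2 -> X :|: nbrs e X = setT.

(** * Even cycles with a largest connected complement *)

Section MaximalPair.

Variables (T : finType) (e : rel T).
Hypothesis e_sym : symmetric e.
Hypothesis no_2cut : has_no_2cut e.

Implicit Types (A B H K Q : {set T}).

Definition cyc_pair Q H n (v : nat -> T) : Prop :=
  [/\ is_cyc e n v, ~~ odd n, conn e H, Q \subset H & [disjoint cset n v & H]].

(** The maximum ranges over all even cycles, not only [v]: changing the cycle is what lets [H] grow.
    Only [Q] is fixed, later a single vertex or an odd cycle. *)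
Definition max_pair Q H n v : Prop :=
  cyc_pair Q H n v /\ forall H' n' v', cyc_pair Q H' n' v' -> #|H'| <= #|H|.

Lemma max_pair_ex Q n v : conn e Q -> is_cyc e n v -> ~~ odd n ->
  [disjoint cset n v & Q] -> exists H m w, max_pair Q H m w.
Proof.
move=> cQ hv on dis.
have [|H [m [w hw]] mx] :=
    @exists_largest_set _ (fun H : {set T} => exists m, exists w, cyc_pair Q H m w).
  by exists Q, n, v.
by exists H, m, w; split=> // H' n' v' h; apply: mx; exists n', v'.
Qed.

Lemma max_pair_shift Q H n v k : max_pair Q H n v ->
  max_pair Q H n (fun i => v (k + i)).
Proof.
move=> [[hv on cH QH dis] mx]; split=> //; split=> //; first exact: cyc_shift.
by rewrite (cset_shift k hv).
Qed.

Lemma nbrs_gt2 K z : K != set0 -> z \notin K :|: nbrs e K -> 2 < #|nbrs e K|.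
Proof.
move=> K0; rewrite ltnNge; apply: contraNN => h.
by rewrite no_2cut // inE.
Qed.

(** A neighbour of [H] off the cycle could be added to [H]. *)
Lemma max_pair_closed Q H n v x y : max_pair Q H n v ->
  x \in H -> e x y -> y \notin H -> y \in cset n v.
Proof.
move=> [[hv on cH QH dis] mx] xH exy yH; apply/negPn/negP => yD.
suff /mx : cyc_pair Q (y |: H) n v by rewrite cardsU1 yH ltnn.
split=> //; first exact: conn_add exy.
  exact: subset_trans QH (subsetUr _ _).
by rewrite disjoint_setU1r yD.
Qed.

(* Both cycles formed by the path through [K] and one of the arcs are even, and
   one of the arcs left out contains a neighbour of [H], by which [H] can grow. *)
Lemma max_pair_reroute Q H n v K f i d x y z : max_pair Q H n v ->
  H != set0 -> z \notin H :|: cset n v ->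
  {in K &, forall x y, exists n, lpath e K x y n /\ odd n = f x (+) f y} ->
  [disjoint K & H :|: cset n v] -> 0 < d < n ->
  x \in K -> y \in K -> e (v i) x -> e (v (i + d)) y ->
  odd d = f x (+) f y -> False.
Proof.
move=> mp; have [[hv on cH QH dis] mx] := mp => H0 zHD hf dK /andP[d0 dn] xK yK ex ey od'.
have [p [hp op]] := hf x y xK yK.
set v' := fun t => v (i + t); have hv' : is_cyc e n v' by apply: cyc_shift.
have cE : cset n v' = cset n v by apply: cset_shift hv.
have ey' : e (v' (0 + d)) y by rewrite /v' add0n.
have ex' : e (v' 0) x by rewrite /v' addn0.
have dDK : [disjoint cset n v' & K].
  by rewrite cE disjoint_sym; apply: disjointWr dK; apply: subsetUr.
have grow w m u : hascyc e w m -> ~~ odd m -> u \in nbrs e H ->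
    [disjoint w & u |: H] -> False.
  move=> /hascyc_fun [c hc cw] om /nbrsP[uH [a aH eau]] dw.
  suff /mx : cyc_pair Q (u |: H) m c by rewrite cardsU1 uH ltnn.
  split=> //; first exact: conn_add eau.
    exact: subset_trans QH (subsetUr _ _).
  by apply: disjointWl dw; apply: arc_set_sub.
have N2 : 2 < #|nbrs e H|.
  apply: (@nbrs_gt2 _ z) => //; move: zHD; rewrite !in_setU !negb_or.
  case/andP=> zH zD; rewrite zH /=; apply: contraNN zD => /nbrsP[_ [h hH ehz]].
  exact: (max_pair_closed mp hH ehz zH).
have [u uN [u0 ud]] := card_gt2_avoid (v' 0) (v' d) N2.
have uD : u \in cset n v'.
  have [uH [h hH ehu]] := nbrsP _ _ _ uN.
  by rewrite cE; apply: (max_pair_closed mp hH ehu uH).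
have [k nk uk] := csetP _ hv' uD.
have k0 : k != 0 by apply: contraNneq u0 => k0; rewrite uk k0.
have kd : k != d by apply: contraNneq ud => kd; rewrite uk kd.
have od : odd d = odd p by rewrite op.
have disj i' d' : u \notin arc_set v' i' d' -> [disjoint arc_set v' i' d' :|: K & u |: H].
  move=> nu; rewrite disjoint_setU1r inE negb_or nu (disjointFr dDK uD) /=.
  rewrite disjoint_setUl (disjointWr (subsetUl _ _) dK) andbT.
  apply: disjointWl dis; rewrite -cE.
  by apply: arc_set_sub => t; apply: mem_cset hv'.
have [kd'|kd'] := ltnP k d.
  apply: (grow _ _ u (theta_compl e_sym hv' hp dDK ex' ey' _ _)) => //.
  - by rewrite d0 ltnW.
  - by rewrite addn_gt0 subn_gt0 dn.
  - by rewrite /= oddD oddB ?(ltnW dn) // od negbK (negbTE on) addbb.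
  apply: disj; rewrite uk; apply/arc_setP => -[t tn /(cyc_inj hv')].
  rewrite add0n (modn_small nk); clear -tn k0 kd' dn.
  have [->|tn'] := eqVneq t (n - d); first by rewrite subnKC ?modnn; lia.
  by rewrite modn_small; lia.
apply: (grow _ _ u (theta e_sym hv' hp dDK ex' ey' _ _)) => //.
- by rewrite addn_gt0 d0.
- by rewrite /= oddD od negbK addbb.
apply: disj; rewrite uk; apply/arc_setP => -[t tn /(cyc_inj hv')].
by rewrite add0n !modn_small //; clear -tn kd' kd dn; lia.
Qed.

(** A component [K] of the rest has three attachments on the cycle. Give the attachment of [v i] to
    [x] the bit [odd i (+) f x]: two of the three bits agree, and the cycle can be rerouted through
    [K] between those two. *)
Lemma max_pair_cover Q H n v : max_pair Q H n v -> H != set0 ->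
  H :|: cset n v = setT.
Proof.
move=> mp H0; apply/setP=> w; rewrite in_setT; apply/negPn/negP => wHD.
have [[hv on cH QH dis] mx] := mp.
have [|K [KA cK wK Kcl]] := @component_ex _ e e_sym (~: (H :|: cset n v)) w.
  by rewrite inE.
have dK : [disjoint K & H :|: cset n v] by rewrite disjoints_subset.
have ND : nbrs e K \subset cset n v.
  apply/subsetP=> y /nbrsP[yK [x xK exy]]; have := subsetP KA x xK.
  rewrite in_setC in_setU negb_or => /andP[xH xD]; apply: contraNT yK => yD.
  apply: (Kcl x) => //; rewrite in_setC in_setU negb_or yD andbT.
  apply: contraNN xD => yH; apply: (max_pair_closed mp yH) => //.
  by rewrite e_sym.
have [f hf] := conn_color e_sym cK.
have [h hH] := set0Pn _ H0.
have /card_gt2P[a [b [c [[aK bK cK'] [ab bc ca]]]]] : 2 < #|nbrs e K|.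
  apply: (@nbrs_gt2 _ h); first by apply/set0Pn; exists w.
  rewrite in_setU negb_or (disjointFl dK) ?in_setU ?hH //=.
  by apply: contraTN hH => /(subsetP ND) hD; rewrite (disjointFr dis).
have ind y : y \in nbrs e K -> exists i x, [/\ i < n, y = v i, x \in K & e (v i) x].
  move=> yN; have [i ni yi] := csetP _ hv (subsetP ND _ yN).
  have [_ [x xK exy]] := nbrsP _ _ _ yN.
  by exists i, x; split=> //; rewrite -yi e_sym.
have [i [x [ni ai xK ex]]] := ind a aK.
have [j [y [nj bj yK ey]]] := ind b bK.
have [k [t [nk ck tK et]]] := ind c cK'.
have no i' j' x' y' : i' < n -> j' < n -> x' \in K -> y' \in K ->
    e (v i') x' -> e (v j') y' -> v i' != v j' ->
    odd i' (+) odd j' = f x' (+) f y' -> False.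
  move=> ni' nj' xK' yK' ex' ey' nij o.
  have [ij|ij|ij] := ltngtP i' j'; last by rewrite ij eqxx in nij.
    apply: (@max_pair_reroute _ _ _ _ _ _ i' (j' - i') _ _ _ mp H0 wHD hf dK _
      xK' yK' ex').
    + by rewrite subn_gt0 ij (leq_ltn_trans (leq_subr _ _) nj').
    + by rewrite subnKC // ltnW.
    + by rewrite oddB 1?ltnW // addbC.
  apply: (@max_pair_reroute _ _ _ _ _ _ j' (i' - j') _ _ _ mp H0 wHD hf dK _
    yK' xK' ey').
  + by rewrite subn_gt0 ij (leq_ltn_trans (leq_subr _ _) ni').
  + by rewrite subnKC // ltnW.
  + by rewrite oddB 1?ltnW // o addbC.
rewrite ai bj ck in ab bc ca.
have h1 := no _ _ _ _ ni nj xK yK ex ey ab.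
have h2 := no _ _ _ _ nj nk yK tK ey et bc.
have h3 := no _ _ _ _ nk ni tK xK et ex ca.
move: h1 h2 h3; case: (odd i); case: (odd j); case: (odd k); case: (f x);
  case: (f y); case: (f t) => h1 h2 h3;
  solve [exact: h1|exact: h2|exact: h3].
Qed.

(** The new cycle [w] is again a maximal partner of the same [H], so [H] and [w] already cover the
    graph and no vertex of [v] lies outside [w]. *)
Lemma max_pair_min Q H n v m : max_pair Q H n v -> H != set0 ->
  hascyc e (cset n v) m -> ~~ odd m -> n <= m.
Proof.
move=> mp H0 /hascyc_fun[w hw wv] om; have [[hv on cH QH dis] mx] := mp.
have sub : cset m w \subset cset n v by apply: arc_set_sub.
have mpw : max_pair Q H m w.
  by split=> //; split=> //; apply: disjointWl dis.
rewrite -(card_cset hv) -(card_cset hw); apply: subset_leq_card.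
apply/subsetP=> x xv; have := in_setT x; rewrite -(max_pair_cover mpw H0) inE.
by rewrite (disjointFr dis xv).
Qed.

End MaximalPair.

(** * Chords of the even cycle and its attachments to [H] *)

Section Attachments.

Variables (T : finType) (e : rel T).
Hypotheses (e_sym : symmetric e) (e_irr : irreflexive e).
Hypotheses (no_2cut : has_no_2cut e) (order_ge6 : 6 <= #|T|).
Hypothesis no_win : ~ has_consecutive_even_cycles e.

Implicit Types (A B H K Q : {set T}).

Lemma no_two_cycles A B n : ~~ odd n -> hascyc e A n -> hascyc e B n.+2 -> False.
Proof.
move=> on hA hB; apply: no_win; exists n; split=> //.
  exact: hascyc_sub hA (subsetT _).
exact: hascyc_sub hB (subsetT _).
Qed.

(** Otherwise [A] and its neighbours, at most [3 + 2] vertices, would be the whole graph. *)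
Lemma card_nbrs_small A : A != set0 -> #|A| <= 3 -> 2 < #|nbrs e A|.
Proof.
move=> A0 A3; rewrite ltnNge; apply/negP => N2; have E := no_2cut A0 N2.
have := order_ge6; rewrite -cardsT -E.
have [le _] := leq_card_setU A (nbrs e A).
by move/leq_trans => /(_ _ le) /leq_trans /(_ (leq_add A3 N2)).
Qed.

Lemma card_nbrs1 x : 2 < #|nbrs e [set x]|.
Proof. by apply: card_nbrs_small; rewrite -?card_gt0 cards1. Qed.

Lemma third_nbr x p q : exists y, [/\ e x y, y != p & y != q].
Proof.
have [y /nbrsP[_ [z]]] := card_gt2_avoid p q (card_nbrs1 x).
by rewrite inE => /eqP -> exy [yp yq]; exists y.
Qed.

Lemma edge_neq x y : e x y -> x != y.
Proof. by apply: contraTneq => ->; rewrite e_irr. Qed.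

Definition attached H x : Prop := exists2 h, h \in H & e x h.

Section OnePair.

Variables (Q H : {set T}) (s : nat) (v : nat -> T).
Hypothesis mp : max_pair e Q H s.*2 v.
Hypothesis H_neq0 : H != set0.

Let hv : is_cyc e s.*2 v. Proof. by case: mp => -[]. Qed.
Let s_gt1 : 1 < s. Proof. by case: hv; nat_lia. Qed.
Let cH : conn e H. Proof. by case: mp => -[]. Qed.
Let dis : [disjoint cset s.*2 v & H]. Proof. by case: mp => -[]. Qed.
Let cover : H :|: cset s.*2 v = setT. Proof. exact: max_pair_cover mp H_neq0. Qed.
Let minimal m : hascyc e (cset s.*2 v) m -> ~~ odd m -> s.*2 <= m.
Proof. exact: max_pair_min mp H_neq0. Qed.

Lemma antipodal_parity i x y p : lpath e H x y p -> e (v i) x ->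
  e (v (i + s.-1)) y -> odd p = odd s.
Proof.
move=> hp ex ey; apply/eqP/negPn/negP => op.
apply: (@no_two_cycles _ _ (s.-1 + p).+2 _
  (theta e_sym hv hp dis ex ey _ _)); try nat_lia.
have E : (s.-1 + p).+4 = (s.*2 - s.-1 + p).+2 by nat_lia.
rewrite E; apply: (theta_compl e_sym hv hp dis ex ey); nat_lia.
Qed.

(** Two edges close two disjoint arcs to a cycle; the disjunction lists the two ways of matching
    their ends. *)
Lemma arcs_hascyc i d j d' m : i + d < j -> j + d' < i + s.*2 -> 0 < d + d' ->
  (e (v (i + d)) (v j) && e (v (j + d')) (v i)) ||
  (e (v (i + d)) (v (j + d')) && e (v j) (v i)) ->
  m = (d + d').+2 -> hascyc e (cset s.*2 v) m.
Proof.
move=> h1 h2 dd ee ->.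
have sub : arc_set v i d :|: arc_set v j d' \subset cset s.*2 v.
  by rewrite subUset; apply/andP; split; apply: arc_set_sub => k; apply: mem_cset hv.
apply: hascyc_sub sub.
have dij : [disjoint arc_set v i d & arc_set v j d'] by apply: arc_set_disjoint hv _ _.
have a1 : lpath e (arc_set v i d) (v i) (v (i + d)) d.
  by apply: (cyc_arc _ hv); nat_lia.
have a2 : lpath e (arc_set v j d') (v j) (v (j + d')) d'.
  by apply: (cyc_arc _ hv); nat_lia.
case/orP: ee => /andP[e1 e2]; first exact: (lpath_glue a1 a2 dij).
exact: (lpath_glue a1 (lpath_rev e_sym a2) dij).
Qed.

(** For odd [d] the chord closes an even cycle of length [d + 1] on vertices of [v], shorter than
    [v]. *)
Lemma chord_even i d : 1 < d -> d.+1 < s.*2 -> e (v i) (v (i + d)) -> ~~ odd d.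
Proof.
move=> d1 dn ech; apply/negP => od.
suff : s.*2 <= d.+1 by nat_lia.
apply: minimal; last by rewrite /= od.
apply: (hascyc_sub (A := arc_set v i d)); last first.
  by apply: arc_set_sub => k; apply: mem_cset hv.
by apply: (lpath_close (cyc_arc i hv _)); rewrite 1?e_sym //; nat_lia.
Qed.

(** Chords have even span, so the cycles formed below from two chords and two arcs are even, and one
    of them is too short for [minimal]. Index 0 is an end of the first chord, which a shift
    arranges. *)
Lemma chord_uniq a b c : 2 < s -> 1 < a -> a.+1 < s.*2 -> e (v 0) (v a) ->
  b.+1 < c -> c < s.*2 -> c - b < s.*2.-1 -> e (v b) (v c) -> b = 0 /\ c = a.
Proof.
move=> s2 a1 an ea bc cn cbn ebc.
have oa : ~~ odd a := @chord_even 0 a a1 an ea.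
have obc : ~~ odd (c - b).
  by apply: (@chord_even b); [nat_lia|nat_lia|rewrite subnKC //; nat_lia].
have ea' : e (v a) (v 0) by rewrite e_sym.
have v0 : v s.*2 = v 0 by case: hv => _ _ /(_ 0).
have ecb : e (v c) (v b) by rewrite e_sym.
have no m i d j d' := fun h1 h2 h3 h4 h5 =>
  @minimal m (@arcs_hascyc i d j d' m h1 h2 h3 h4 h5).
have [ca|ac] := leqP c a.
  have [/andP[/eqP -> /eqP ->] //|ne] := boolP ((b == 0) && (c == a)).
  have {}ne : 0 < b + (a - c) by clear -ne ca; lia.
  suff : s.*2 <= (b + (a - c)).+2 by nat_lia.
  apply: (no _ 0 b c (a - c)) => //; try nat_lia.
  by rewrite subnKC // ebc ea'.
have [ab|ba] := leqP a b.
  suff : s.*2 <= (b - a + (s.*2 - c)).+2 by nat_lia.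
  apply: (no _ a (b - a) c (s.*2 - c)) => //; try nat_lia.
  by rewrite !subnKC ?v0 ?ebc ?ea //; nat_lia.
(* If the chords share [v 0], the second arc is this single vertex, indexed [s.*2] so that it comes
   after the first arc. *)
have [b0|b0] := posnP b.
  suff : s.*2 <= (c - a + 0).+2 by nat_lia.
  apply: (no _ a (c - a) s.*2 0) => //; try nat_lia.
  by rewrite addn0 subnKC ?v0 ?ea -?b0 ?ecb //; nat_lia.
(* The chords cross. The two even cycles through both have total length [s.*2 + 4], less than twice
   [s.*2] because [2 < s]. *)
have h1 : s.*2 <= (b + (c - a)).+2.
  apply: (no _ 0 b a (c - a)) => //; try nat_lia.
  by rewrite subnKC ?ebc ?ea' ?orbT //; nat_lia.
have h2 : s.*2 <= (a - b + (s.*2 - c)).+2.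
  apply: (no _ b (a - b) c (s.*2 - c)) => //; try nat_lia.
  by rewrite !subnKC ?v0 ?ecb ?ea' ?orbT //; nat_lia.
nat_lia.
Qed.

Lemma unattached_chord i : ~ attached H (v i) ->
  exists d, [/\ 1 < d, d.+1 < s.*2 & e (v i) (v (i + d))].
Proof.
move=> na; have [y [ey y1 y2]] := third_nbr (v i) (v (i + 1)) (v (i + s.*2.-1)).
have : y \in H :|: cset s.*2 v by rewrite cover.
rewrite inE => /orP[yH|]; first by case: na; exists y.
have hvi := cyc_shift i hv; rewrite -(cset_shift i hv) => /(csetP _ hvi)[d dn yd].
exists d; rewrite -yd; split=> //.
  have d0 : d != 0.
    by apply: contraTneq ey => d0; rewrite yd d0 addn0 e_irr.
  have d1 : d != 1 by apply: contraNneq y1 => d1; rewrite yd d1.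
  by clear -d0 d1; nat_lia.
have d1 : d != s.*2.-1 by apply: contraNneq y2 => d1; rewrite yd d1.
by clear -d1 dn; nat_lia.
Qed.

End OnePair.

(** An unattached vertex has a third neighbour on the cycle, hence a chord, so the exceptions are
    the ends of the only chord. For [s = 2] uniqueness fails, but [H] has three neighbours among
    four vertices. The parity clause keeps all odd indices attached for [half_length_even]. *)
Lemma attached_cover Q H s v : max_pair e Q H s.*2 v -> H != set0 ->
  exists k a, [/\ 0 < a < s.*2, odd s -> ~~ odd a
    & forall i, i < s.*2 -> i != 0 -> i != a -> attached H (v (k + i))].
Proof.
move=> mp H0; have [[hv _ cH _ dis] _] := mp.
have s1 : 1 < s by case: hv; nat_lia.
have [all|] := classic (forall i, attached H (v i)).
  (* There is no exception; 2 is an arbitrary even index. *)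
  by exists 0, 2; split=> //; nat_lia.
case/not_all_ex_not => k nk; exists k.
have mpk := max_pair_shift k mp; have [[hvk _ _ _ disk] _] := mpk.
have nk0 : ~ attached H (v (k + 0)) by rewrite addn0.
have [s2|s2] := ltnP 2 s.
  have [a [a1 an ea]] := unattached_chord mpk H0 nk0.
  exists a; split.
  - by apply/andP; nat_lia.
  - by move=> _; apply: (chord_even mpk H0 a1 an ea).
  move=> i ni i0 ia; apply: NNPP => /(unattached_chord mpk H0)[d [d1 dn]].
  have uniq b c := @chord_uniq _ _ _ _ mpk H0 a b c s2 a1 an ea.
  have [id|id] := ltnP (i + d) s.*2 => ech.
    have [/eqP] := uniq i (i + d) ltac:(nat_lia) ltac:(nat_lia) ltac:(nat_lia) ech.
    by rewrite (negbTE i0).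
  have ech' : e (v (k + (i + d - s.*2))) (v (k + i)).
    rewrite e_sym; move: ech; have -> : k + (i + d) = k + (i + d - s.*2) + s.*2 by nat_lia.
    by have [_ _ -> _] := hv.
  have [_ /eqP] := uniq (i + d - s.*2) i ltac:(nat_lia) ltac:(nat_lia) ltac:(nat_lia) ech'.
  by rewrite (negbTE ia).
have s_2 : s = 2 by nat_lia.
(* Only [v k] is unattached, so 2 is again arbitrary. *)
exists 2; split; rewrite ?s_2 //.
move=> i ni i0 i2; apply: NNPP => nki.
have : 2 < #|nbrs e H|.
  apply: (nbrs_gt2 no_2cut (z := v k)) => //.
  rewrite in_setU negb_or (disjointFr dis) ?(mem_cset _ hv) //=.
  apply/negP => /nbrsP[_ [h hH ehv]]; apply: nk; exists h => //.
  by rewrite e_sym.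
suff : #|nbrs e H| <= #|cset s.*2 v :\ v k :\ v (k + i)|.
  have := card_cset hv; rewrite (cardsD1 (v k)) (mem_cset _ hv) => E.
  move: E; rewrite (cardsD1 (v (k + i)) (_ :\ _)) in_setD1 (mem_cset _ hv) andbT.
  have -> : v (k + i) != v k.
    apply: contraNneq i0; rewrite -[in v k](addn0 k) => /(cyc_inj hvk).
    by rewrite s_2 modn_small // mod0n => ->.
  by rewrite s_2; nat_lia.
apply: subset_leq_card; apply/subsetP => y /nbrsP[yH [h hH ehy]].
rewrite !in_setD1 (max_pair_closed e_sym mp hH ehy yH) andbT.
by apply/andP; split; apply/eqP => E; [apply: nki|apply: nk]; exists h;
  rewrite // -E e_sym.
Qed.

(* The antipodal relation [i -- i + (s - 1)] is a cycle of odd length [s] on the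
   odd indices, along which a spanning-tree colouring of [H] would alternate. *)
Lemma half_length_even Q H s v : max_pair e Q H s.*2 v -> H != set0 -> ~~ odd s.
Proof.
move=> mp0 H0; apply/negP => os; have [k [a [an oa hatt]]] := attached_cover mp0 H0.
have mp := max_pair_shift k mp0; have [[hv _ cH _ dis] _] := mp.
set v' := (fun i => v (k + i)) in mp hv dis.
have {}oa := oa os.
have att i : odd i -> attached H (v' i).
  move=> oi; rewrite -(cyc_mod i hv); apply: hatt.
  - by rewrite ltn_mod; case: hv; nat_lia.
  - by apply: contraTneq oi => h; rewrite (divn_eq i s.*2) h; nat_lia.
  apply: contraTneq oi => h; rewrite (divn_eq i s.*2) h.
  by rewrite oddD oddM odd_double andbF.
have [f hf] := conn_color e_sym cH.
(* The default [w] is never reached at odd indices, which are attached. *)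
pose F w := f (odflt w [pick x in H | e w x]).
have step i : odd i -> F (v' (i + s.-1)) = ~~ F (v' i).
  move=> oi; have oi' : odd (i + s.-1) by nat_lia.
  have pickP' j : odd j -> exists2 x, x \in H /\ e (v' j) x & F (v' j) = f x.
    move=> /att[x xH ex]; rewrite /F; case: pickP => [y /andP[yH ey]|no].
      by exists y.
    by have := no x; rewrite /= xH ex.
  have [x [xH ex] ->] := pickP' _ oi; have [y [yH ey] ->] := pickP' _ oi'.
  have [p [hp op]] := hf _ _ xH yH.
  have := antipodal_parity mp H0 hp ex ey; rewrite op os.
  by case: (f x); case: (f y).
have iter t : F (v' (1 + t * s.-1)) = F (v' 1) (+) odd t.
  elim: t => [|t IH]; first by rewrite mul0n addbF.
  rewrite mulSnr addnA step; last by rewrite oddD oddM -subn1 oddB ?os ?andbF //; nat_lia.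
  by rewrite IH /= addbN.
(* As [s.-1] is even, [s * s.-1] is a multiple of [s.*2]: the walk closes up after [s] alternations,
   an odd number. *)
have := iter s; have -> : v' (1 + s * s.-1) = v' 1.
  rewrite -(cyc_mod _ hv) -(cyc_mod 1 hv); congr v'.
  have -> : s.-1 = s./2.*2 by nat_lia.
  rewrite -!muln2 mulnCA.
  by rewrite addnC modnMDl.
by rewrite os; case: (F _).
Qed.

End Attachments.

(** * Even cycles meet odd cycles *)

Section OddLinked.

Variables (T : finType) (e : rel T).
Hypothesis e_sym : symmetric e.

Implicit Types (A B H K Q X : {set T}).

Definition both_parities A x y : Prop :=
  forall b : bool, exists p, lpath e A x y p /\ odd p = b.

(** Generalizes the vertex set of an odd cycle, and unlike it is preserved by adding ears, so a
    largest such set leaves no piece attached to it at two vertices. *)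
Definition oddlinked B : Prop :=
  {in B &, forall x y, x != y -> both_parities B x y}.

Lemma both_parities_sym A x y : both_parities A x y -> both_parities A y x.
Proof.
by move=> h b; have [p [hp op]] := h b; exists p; split=> //; apply: lpath_rev.
Qed.

Lemma both_paritiesS A B x y : both_parities A x y -> A \subset B ->
  both_parities B x y.
Proof.
by move=> h AB b; have [p [hp op]] := h b; exists p; split=> //; apply: lpath_sub hp AB.
Qed.

Lemma both_parities_catl A B a b x y n : lpath e A a b n ->
  both_parities B x y -> [disjoint A & B] -> e b x ->
  both_parities (A :|: B) a y.
Proof.
move=> hA hB dis ebx c; have [p [hp op]] := hB (c (+) ~~ odd n).
exists (n + p).+1; split; first exact: lpath_cat hA hp dis ebx.
by rewrite /= oddD op; case: (c); case: (odd n).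
Qed.

Lemma both_parities_joinl A B a b y n : lpath e A a b n ->
  both_parities B b y -> (forall z, z \in A -> z \in B -> z = b) ->
  both_parities (A :|: B) a y.
Proof.
move=> hA hB dis c; have [p [hp op]] := hB (c (+) odd n).
exists (n + p); split; first exact: lpath_join hA hp dis.
by rewrite oddD op; case: (c); case: (odd n).
Qed.

(** The two arcs between a pair of vertices have lengths [d] and [n - d], of different parity. *)
Lemma oddlinked_cset n v : is_cyc e n v -> odd n -> oddlinked (cset n v).
Proof.
move=> hv on x y /(csetP _ hv)[i ni ->] /(csetP _ hv)[j nj ->] nij.
have [d dn vd] : exists2 d, d < n & v j = v (i + d).
  have hvi := cyc_shift i hv; have : v j \in cset n v by apply: mem_cset hv.
  by rewrite -(cset_shift i hv) => /(csetP _ hvi)[d dn ->]; exists d.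
rewrite vd in nij *.
have h1 : lpath e (cset n v) (v i) (v (i + d)) d.
  by apply: lpath_sub (cyc_arc i hv dn) _; apply: arc_set_sub => k; apply: mem_cset hv.
have h2 : lpath e (cset n v) (v i) (v (i + d)) (n - d).
  have d0 : 0 < d by case: d nij {vd dn h1} => //; rewrite addn0 eqxx.
  have nd : n - d < n by nat_lia.
  have := cyc_arc (i + d) hv nd; rewrite -addnA subnKC ?(ltnW dn) //.
  have [_ _ -> _] := hv => /(lpath_rev e_sym) h.
  by apply: lpath_sub h _; apply: arc_set_sub => k; apply: mem_cset hv.
move=> b; have [od|od] := eqVneq (odd d) b; first by exists d.
exists (n - d); split=> //; rewrite oddB ?(ltnW dn) // on.
by case: b od; case: (odd d).
Qed.

(** From an ear vertex to [w] in [B], leave the ear at a foot other than [w] and use both parities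
    in [B]. Between two ear vertices, go outwards to the two feet and cross [B]. *)
Lemma oddlinked_ear B K x y m b b' : oddlinked B -> lpath e K x y m ->
  [disjoint B & K] -> b \in B -> b' \in B -> b != b' -> e b x -> e b' y ->
  exists B', [/\ oddlinked B', B \proper B' & B' \subset B :|: K].
Proof.
move=> oB /(lpath_fun)[u [u0 um ue uinj uK]] dBK bB b'B nb ex ey.
have earK : arc_set u 0 m \subset K.
  by apply/subsetP=> z /arc_setP[k km ->]; apply: uK.
have uP z : z \in arc_set u 0 m -> exists2 i, i <= m & z = u i.
  by case/arc_setP => i im ->; exists i.
have sub i d : i + d <= m -> lpath e (arc_set u i d) (u i) (u (i + d)) d.
  move=> im; apply: lpath_arc => [k kd|k l kd ld E]; first by apply: ue; nat_lia.
  by have := uinj _ _ _ _ E; nat_lia.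
have dB i d : i + d <= m -> [disjoint arc_set u i d & B].
  move=> im; rewrite disjoint_sym; apply: disjointWr dBK; apply/subsetP.
  by move=> z /arc_setP[k kd ->]; apply: uK; nat_lia.
have arcS i d : i + d <= m -> arc_set u i d \subset arc_set u 0 m.
  move=> im; apply/subsetP => z /arc_setP[k kd ->]; apply/arc_setP.
  by exists (i + k) => //; nat_lia.
have toB i w : i <= m -> w \in B -> w != b ->
    both_parities (arc_set u 0 i :|: B) (u i) w.
  move=> im wB wb.
  apply: (both_parities_catl (lpath_rev e_sym (sub 0 i im)) (x := b)).
  - by apply: oB => //; rewrite eq_sym.
  - exact: dB.
  - by rewrite u0 e_sym.
have fromB i w : i <= m -> w \in B -> w != b' ->
    both_parities (arc_set u i (m - i) :|: B) (u i) w.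
  move=> im wB wb; have im' : i + (m - i) <= m by nat_lia.
  apply: (both_parities_catl (sub i (m - i) im') (x := b')).
  - by apply: oB => //; rewrite eq_sym.
  - exact: dB.
  - by rewrite subnKC // um e_sym.
have earB i w : i <= m -> w \in B -> both_parities (B :|: arc_set u 0 m) (u i) w.
  move=> im wB; rewrite setUC; have [wb|wb] := eqVneq w b.
    have wb' : w != b' by rewrite wb.
    apply: both_paritiesS (fromB i w im wB wb') _; apply: setSU; apply: arcS.
    by nat_lia.
  apply: both_paritiesS (toB i w im wB wb) _; apply: setSU; exact: arcS.
have earear i j : i < j <= m -> both_parities (B :|: arc_set u 0 m) (u i) (u j).
  case/andP=> ij jm; have im : i <= m by nat_lia.
  have nb' : b' != b by rewrite eq_sym.
  have h := toB i b' im b'B nb'.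
  have jm' : j + (m - j) <= m by nat_lia.
  have h2 := both_parities_catl (sub j _ jm') (both_parities_sym h).
  apply: both_paritiesS (both_parities_sym (h2 _ _)) _.
  - rewrite disjoint_sym disjoint_setUl; apply/andP; split; last first.
      by rewrite disjoint_sym; apply: dB.
    rewrite disjoint_subset; apply/subsetP => z /arc_setP[k ki ->].
    rewrite inE; apply/arc_setP => -[l lm E].
    by have := uinj _ _ _ _ E; nat_lia.
  - by rewrite subnKC // um e_sym.
  - by rewrite setUA setUC; apply: setUS; rewrite subUset !arcS.
exists (B :|: arc_set u 0 m); split; last exact: setUS.
- move=> z w; rewrite !in_setU => /orP[zB|/uP[i im ->]] /orP[wB|/uP[j jm ->]] nzw.
  + by apply: both_paritiesS (subsetUl _ _); apply: oB.
  + exact/both_parities_sym/earB.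
  + exact: earB.
  have [ij|ji|ij] := ltngtP i j; last by rewrite ij eqxx in nzw.
    by apply: earear; rewrite ij.
  by apply/both_parities_sym/earear; rewrite ji.
- rewrite properE subsetUl; apply/subsetPn; exists (u 0).
    by rewrite in_setU; apply/orP; right; apply/arc_setP; exists 0.
  by rewrite (disjointFl dBK) // uK.
Qed.

End OddLinked.

(** * Pieces hanging on a maximal oddlinked set *)

Section Projections.

Variables (T : finType) (e : rel T).
Hypothesis e_sym : symmetric e.
Variables (H B : {set T}).
Hypotheses (BH : B \subset H) (oB : oddlinked e B).
Hypothesis B_max : forall B', oddlinked e B' -> B \subset B' -> B' \subset H ->
  #|B'| <= #|B|.

Implicit Types (K X : {set T}).

(** With two feet, a path through [K] would be an ear enlarging [B]. *)
Lemma lobe_uniq K b b' y y' : conn e K -> K \subset H :\: B ->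
  b \in B -> b' \in B -> y \in K -> y' \in K -> e b y -> e b' y' -> b = b'.
Proof.
move=> cK /subsetDP[KH dK] bB b'B yK y'K ey ey'; apply/eqP/negPn/negP => nb.
have [m hm] := cK _ _ yK y'K; rewrite disjoint_sym in dK.
have [B' [oB' BB' B'K]] := oddlinked_ear e_sym oB hm dK bB b'B nb ey ey'.
have := proper_card BB'; rewrite ltnNge B_max //; first exact: proper_sub.
by apply: subset_trans B'K _; rewrite subUset BH.
Qed.

(* [K] is empty when [w] is adjacent to [b] itself. *)
Definition projects w b : Prop := b \in B /\
  exists K x m, [/\ conn e K, K \subset H :\: B,
    (forall z, z \in K -> exists2 y, y \in K & e b y),
    lpath e (b |: K) x b m & e w x].

(** The pieces [K] and [K'] are disjoint, or their union would be a piece with feet [b] and [b']. So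
    the paths to [b] and [b'] can be joined by a path of either parity inside [B]. *)
Lemma projects_link w w' b b' : projects w b -> projects w' b' -> b != b' ->
  exists x x', [/\ e w x, e w' x' & both_parities e H x x'].
Proof.
move=> [bB [K [x [m [cK KHB adK hx ex]]]]] [b'B [K' [x' [m' [cK' KHB' adK' hx' ex']]]]] nb.
have [KH dK] := subsetDP KHB; have [KH' dK'] := subsetDP KHB'.
have dKK' : [disjoint K & K'].
  apply/pred0P => z /=; apply/negP => /andP[zK zK'].
  have [y yK ey] := adK z zK; have [y' yK' ey'] := adK' z zK'.
  move: nb; rewrite (@lobe_uniq (K :|: K') b b' y y') ?eqxx //.
  - exact: (connU e_sym cK cK' zK zK').
  - by rewrite subUset KHB.
  - by rewrite inE yK.
  - by rewrite inE yK' orbT.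
exists x, x'; split=> //.
have h1 : both_parities e (B :|: (b' |: K')) b x'.
  apply/both_parities_sym => //; rewrite setUC.
  apply: (both_parities_joinl hx'); first by apply: oB => //; rewrite eq_sym.
  by move=> z /setU1P[->//|zK'] zB; rewrite (disjointFr dK' zK') in zB.
apply: (both_paritiesS (both_parities_joinl hx h1 _)).
  move=> z /setU1P[->//|zK]; rewrite !inE (disjointFr dK zK) (disjointFr dKK' zK) orbF.
  by move=> /eqP zb; move: zK; rewrite zb (disjointFl dK b'B).
by rewrite !subUset !sub1set KH KH' BH !(subsetP BH).
Qed.

(** The piece is taken inside [X] rather than [H], which puts its foot in [X]; in [even_meets_odd]
    this [X] avoids the two cut vertices. *)
Lemma projects_ex X b0 w x : conn e X -> X \subset H -> b0 \in B -> b0 \in X ->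
  x \in X -> e w x -> exists2 b, b \in X & projects w b.
Proof.
move=> cX XH b0B b0X xX ex; have [xB|xB] := boolP (x \in B).
  exists x => //; split=> //; exists set0, x, 0; split=> //.
  - by move=> y z; rewrite inE.
  - exact: sub0set.
  - by move=> z; rewrite inE.
  - by apply: lpath1; rewrite !inE eqxx.
have [|K [KXB cK xK Kcl]] := @component_ex _ _ e_sym (X :\: B) x.
  by rewrite inE xB.
have [m hm] := cX _ _ xX b0X.
have b0K : b0 \notin K.
  by apply/negP => /(subsetP KXB); rewrite inE b0B.
have [a [b [aK bK aX bX eab]]] := path_exit hm xK b0K.
have bB : b \in B.
  by apply: contraNT bK => bB; apply: (Kcl a) => //; rewrite inE bB.
exists b => //; split=> //.
have [p hp] := cK _ _ xK aK.
exists K, x, (p + 0).+1; split=> //.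
- exact: subset_trans KXB (setSD _ XH).
- by move=> z zK; exists a => //; rewrite e_sym.
rewrite setUC; apply: (lpath_cat hp) => //; first by apply: lpath1; rewrite inE.
  by rewrite disjoint_sym disjoints1.
exact: eab.
Qed.

End Projections.

(** When the open interval has two indices, agreement of neighbours makes [P] single-valued and
    constant there, with value [c]. On a single index [P] may take several values, and then [w l.+1]
    itself serves as [c]; hence the disjunction. *)
Lemma segment_cut (T : eqType) (P : nat -> T -> Prop) (w : nat -> T) (l r : nat) :
  (forall t, l < t < r -> exists b, P t b) ->
  (forall t b b', P t b -> P t.+1 b' -> b = b') ->
  exists c, forall t b, l < t < r -> P t b -> w t = c \/ b = c.
Proof.
move=> ex agree; have [lr|lr] := leqP r l.+2.
  by exists (w l.+1) => t b lt _; left; congr w; lia.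
have [c hc] : exists b, P l.+1 b by apply: ex; lia.
have [c' hc'] : exists b, P l.+2 b by apply: ex; lia.
exists c => t b /andP[lt tr]; rewrite -(subnKC lt) => hb; right.
have {lt tr} kr : l.+1 + (t - l.+1) < r by lia.
elim: (t - l.+1) b kr hb => [|k IH] b kr hb.
  by rewrite addn0 in hb; rewrite (agree _ _ _ hb hc') (agree _ _ _ hc hc').
have [b1 hb1] : exists b, P (l.+1 + k) b by apply: ex; lia.
rewrite addnS in hb; rewrite -(agree _ _ _ hb1 hb); apply: IH hb1; lia.
Qed.

(** * Two vertices separating an odd cycle from an even one *)

Section EvenMeetsOdd.

Variables (T : finType) (e : rel T).
Hypotheses (e_sym : symmetric e) (e_irr : irreflexive e).
Hypotheses (no_2cut : has_no_2cut e) (order_ge6 : 6 <= #|T|).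
Hypothesis no_win : ~ has_consecutive_even_cycles e.

Lemma pred_even_sq s j : ~~ odd s -> 0 < s ->
  j * s.-1 * s.-1 = j * s./2.-1 * s.*2 + j.
Proof.
move=> es s0; have [r ->] : exists r, s = r.+1.*2 by exists s./2.-1; lia.
rewrite doubleK -!muln2 /=; nia.
Qed.

(* As [(s - 1) ^ 2 = 1] modulo [2 * s], for even [s] the antipodal relation is a
   single cycle through all indices.  The at most two unattached vertices cut it
   into two segments, on each of which the projection to [B] is constant. *)
Lemma max_pair_cut (Q H B : {set T}) s v : max_pair e Q H s.*2 v -> H != set0 ->
  B \subset H -> oddlinked e B ->
  (forall B', oddlinked e B' -> B \subset B' -> B' \subset H -> #|B'| <= #|B|) ->
  B != set0 ->
  exists c1 c2, forall y b, y \in cset s.*2 v -> projects e H B y b ->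
    (y = c1 \/ y = c2) \/ (b = c1 \/ b = c2).
Proof.
move=> mp0 H0 BH oB Bmax /set0Pn[b0 b0B].
have es := half_length_even e_sym e_irr no_2cut order_ge6 no_win mp0 H0.
have [k [a [an _ hatt]]] := attached_cover e_sym e_irr no_2cut order_ge6 mp0 H0.
have mp := max_pair_shift k mp0; have [[hv0 _ _ _ _] _] := mp0.
rewrite -(cset_shift k hv0); clear mp0 hv0.
set v' := (fun i => v (k + i)) in mp hatt *.
have {}hatt i : i < s.*2 -> i != 0 -> i != a -> attached e H (v' i) by apply: hatt.
have [[hv _ cH _ _] _] := mp; have s2 : 1 < s by case: hv; nat_lia.
set n := s.*2 in an hatt hv mp *.
have sq j : j * s.-1 * s.-1 = j %[mod n].
  by rewrite pred_even_sq ?modnMDl // ltnW.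
(* [w] lists the cycle in antipodal order; [w 0] and [w m] below are the only possibly unattached
   vertices. *)
pose w t := v' (t * s.-1).
pose P t b := projects e H B (w t) b.
have agree t b b' : P t b -> P t.+1 b' -> b = b'.
  (* Different projections would give this antipodal pair a path of odd length, against [s] even. *)
  move=> hb hb'; apply/eqP/negPn/negP => nb.
  have [x [x' [ex ex' /(_ true)[p [hp op]]]]] :=
    projects_link e_sym BH oB Bmax hb hb' nb.
  move: ex'; rewrite /w mulSnr => ex'.
  by have := antipodal_parity e_sym order_ge6 no_win mp H0 hp ex ex'; rewrite op (negbTE es).
have wmod t : w (t %% n) = w t.
  by rewrite /w -(cyc_mod _ hv) -(cyc_mod (t * _) hv) modnMml.
have wsurj y : y \in cset n v' -> exists2 t, t < n & y = w t.
  move=> /(csetP _ hv)[i ni ->]; exists (i * s.-1 %% n).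
    by rewrite ltn_mod; nat_lia.
  by rewrite wmod /w -(cyc_mod (_ * _ * _) hv) sq (cyc_mod _ hv).
pose m := a * s.-1 %% n.
have mn : m < n by rewrite ltn_mod; nat_lia.
have exP t : attached e H (w t) -> exists b, P t b.
  case=> x xH ex; have [b _ hb] := projects_ex e_sym cH (subxx _) b0B (subsetP BH _ b0B) xH ex.
  by exists b.
have att t : t < n -> t != 0 -> t != m -> attached e H (w t).
  move=> tn t0 tm; rewrite /w -(cyc_mod _ hv); apply: hatt.
  - by rewrite ltn_mod; nat_lia.
  - apply: contraNneq t0 => h; rewrite -(modn_small tn) -(sq t) -modnMml h.
    by rewrite mul0n mod0n.
  - apply: contraNneq tm => h; rewrite -(modn_small tn) -(sq t) -modnMml h.
    by rewrite /m.
have seg l r h := @segment_cut T P w l r h agree.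
(* If [w m] is attached, only [w 0] can interrupt the order, and it serves as the second cut vertex.
   If just [w m] is unattached, it takes that role and indices run from [m] to [m + n]. If both are,
   each of the two segments supplies one vertex. *)
have [am|nm] := classic (attached e H (w m)).
  have [|c hc] := seg 0 n.
    move=> t /andP[t0 tn]; apply: exP; have [->//|tm] := eqVneq t m.
    by apply: att; rewrite -?lt0n.
  exists c, (w 0) => y b /wsurj[t tn ->] hb.
  case: t tn hb => [|t] tn hb; first by left; right.
  by have [->|->] := hc t.+1 b tn hb; [left; left|right; left].
have [a0|n0] := classic (attached e H (w 0)).
  have [|c hc] := seg m (m + n).
    move=> t /andP[t0 tn]; apply: exP; rewrite -wmod.
    have [->//|tm] := eqVneq (t %% n) 0.
    apply: att => //; first by rewrite ltn_mod; nat_lia.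
    have [tn'|tn'] := ltnP t n; first by rewrite modn_small // neq_ltn t0 orbT.
    have -> : t = t - n + n by nat_lia.
    by rewrite modnDr modn_small; nat_lia.
  exists c, (w m) => y b /wsurj[t tn ->] hb.
  have [tm|tm|->] := ltngtP t m; last by left; right.
    have E : w (t + n) = w t by rewrite -wmod modnDr wmod.
    have [|||->] := hc (t + n) b; rewrite ?E; [nat_lia|by rewrite /P E| |].
      by move=> ->; left; left.
    by right; left.
  have [|||->] := hc t b => //; first by nat_lia.
    by move=> ->; left; left.
  by right; left.
have no t b : ~ attached e H (w t) -> ~ P t b.
  move=> nt [bB [K [x [p [cK KHB _ hx ex]]]]]; apply: nt; exists x => //.
  have [/setU1P[->|xK] _] := lpath_ends hx; first exact: (subsetP BH).
  by have := subsetP KHB x xK; rewrite inE => /andP[].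
have [|c1 hc1] := seg 0 m.
  move=> t /andP[t0 tm]; apply/exP/att; nat_lia.
have [|c2 hc2] := seg m n.
  move=> t /andP[t0 tm]; apply/exP/att; nat_lia.
exists c1, c2 => y b /wsurj[t tn ->] hb.
have t0 : t != 0 by apply/eqP => t0; case: (no t b) => //; rewrite t0.
have [tm|tm|tm] := ltngtP t m.
- by have [||->|->] := hc1 t b; [nat_lia| |left; left|right; left].
- by have [||->|->] := hc2 t b; [nat_lia| |left; right|right; right].
by case: (no t b) => //; rewrite tm.
Qed.

(** With the odd cycle prescribed in [H] and enlarged to [B], some [b0] in [B] avoids [c1] and [c2].
    Its component [X] in [H] minus these two has no other neighbours, since a neighbour on the even
    cycle projects into [X]. Then [X] with [c1], [c2] would be the whole graph, leaving no room for
    the even cycle. *)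
Lemma even_meets_odd N z A n : is_cyc e N z -> odd N -> hascyc e A n ->
  ~~ odd n -> ~~ [disjoint cset N z & A].
Proof.
move=> hz oN /hascyc_fun[v hv vA] on; apply/negP => dzA.
have N2 : 2 < N by case: hz.
have [|H [m [u mp]]] := max_pair_ex (conn_cset e_sym hz) hv on.
  by rewrite disjoint_sym; apply: disjointWr dzA; apply: arc_set_sub.
have [[hu om cH ZH dis] _] := mp.
have cZ := card_cset hz.
have H0 : H != set0.
  by rewrite -card_gt0; have := subset_leq_card ZH; rewrite cZ; nat_lia.
have [s E] : exists s, m = s.*2 by exists m./2; nat_lia.
rewrite {}E in mp hu om dis.
have [|B [BH ZB oB] Bmax] := @exists_largest_set _
    (fun B => [/\ B \subset H, cset N z \subset B & oddlinked e B]).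
  by exists (cset N z); split=> //; apply: oddlinked_cset.
have B2 : 2 < #|B| by have := subset_leq_card ZB; rewrite cZ; nat_lia.
have Bmax' B' : oddlinked e B' -> B \subset B' -> B' \subset H -> #|B'| <= #|B|.
  by move=> oB' BB' B'H; apply: Bmax; split=> //; apply: subset_trans BB'.
have [|c1 [c2 hc]] := max_pair_cut mp H0 BH oB Bmax'.
  by rewrite -card_gt0; nat_lia.
have [b0 b0B [b01 b02]] := card_gt2_avoid c1 c2 B2.
have [|X [XH' cX b0X Xcl]] := @component_ex _ _ e_sym (H :\: [set c1; c2]) b0.
  by rewrite !inE negb_or b01 b02 (subsetP BH).
have [XH dX] := subsetDP XH'.
have NX : nbrs e X \subset [set c1; c2].
  apply/subsetP=> y /nbrsP[yX [x xX exy]]; apply: contraNT yX => yc.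
  have [yH|yH] := boolP (y \in H); first by apply: (Xcl x) => //; rewrite inE yc.
  have yD := max_pair_closed e_sym mp (subsetP XH _ xX) exy yH.
  rewrite e_sym in exy.
  have [b bX hb] := projects_ex e_sym cX XH b0B b0X xX exy.
  have := disjointFr dX bX; move: yc; rewrite !inE !negb_or => /andP[yc1 yc2].
  by case: (hc y b yD hb) => -[] E; rewrite E eqxx ?orbT in yc1 yc2 *.
have X0 : X != set0 by apply/set0Pn; exists b0.
have := no_2cut X0; rewrite (leq_trans (subset_leq_card NX)); last first.
  by rewrite cards2; case: (_ != _).
move/(_ isT) => E.
have : cset s.*2 u \subset [set c1; c2].
  apply/subsetP=> y yD; have := in_setT y; rewrite -E inE.
  case/orP=> [/(subsetP XH) yH|/(subsetP NX) //].
  by rewrite (disjointFr dis yD) in yH.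
move/subset_leq_card; rewrite (card_cset hu) cards2 => h.
by have [] := hu; move: h; case: (_ != _) => /=; nat_lia.
Qed.

End EvenMeetsOdd.

(** * Existence of an odd cycle *)

Section OddCycle.

Variables (T : finType) (e : rel T).
Hypotheses (e_sym : symmetric e) (e_irr : irreflexive e).
Hypotheses (no_2cut : has_no_2cut e) (order_ge6 : 6 <= #|T|).
Hypothesis no_win : ~ has_consecutive_even_cycles e.

Implicit Types (A B H K Q : {set T}).

Lemma chord_cycles n v i d : is_cyc e n v -> 1 < d -> d.+1 < n ->
  e (v i) (v (i + d)) ->
  hascyc e (cset n v) d.+1 /\ hascyc e (cset n v) (n - d).+1.
Proof.
move=> hv d1 dn ch.
have sub j k : arc_set v j k \subset cset n v.
  by apply: arc_set_sub => l; apply: mem_cset hv.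
have dn' : d < n by nat_lia.
have nd : n - d < n by nat_lia.
split.
  apply: hascyc_sub (sub i d); apply: (lpath_close (cyc_arc i hv dn')) => //.
  by rewrite e_sym.
apply: hascyc_sub (sub (i + d) (n - d)).
apply: (lpath_close (cyc_arc (i + d) hv nd)); last by nat_lia.
by rewrite -addnA subnKC ?(ltnW dn') //; have [_ _ -> _] := hv.
Qed.

Lemma off_cycle_or_chord n v i : is_cyc e n v ->
  exists2 y, e (v i) y & y \notin cset n v \/
    exists d, [/\ 1 < d, d.+1 < n & y = v (i + d)].
Proof.
move=> hv.
have [y [ey y1 y2]] := third_nbr no_2cut order_ge6 (v i) (v (i + 1)) (v (i + n.-1)).
exists y => //; have [yD|yD] := boolP (y \in cset n v); [right|by left].
have hvi := cyc_shift i hv.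
move: yD; rewrite -(cset_shift i hv) => /(csetP _ hvi)[d dn yd].
have d0 : d != 0 by apply: contraTneq ey => d0; rewrite yd d0 addn0 e_irr.
have d1 : d != 1 by apply: contraNneq y1 => d1; rewrite yd d1.
have d2 : d != n.-1 by apply: contraNneq y2 => d2; rewrite yd d2.
by exists d; split=> //; nat_lia.
Qed.

Lemma longest_path_ex A : A != set0 -> exists u m,
  [/\ forall k, k <= m -> u k \in A, forall k, k < m -> e (u k) (u k.+1),
      forall k l, k <= m -> l <= m -> u k = u l -> k = l
    & forall x y n, lpath e A x y n -> n <= m].
Proof.
move=> /set0Pn[x0 x0A].
have [|n [x [y [p hp]]]|m [[x [y hm]] mx]] :=
    @ex_max (fun m => exists x y, lpath e A x y m) #|T|.
- by exists 0, x0, x0; apply: lpath1.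
- case: hp => _ _ up <- _; have := max_card (mem (x :: p)).
  by rewrite (card_uniqP up); apply: ltnW.
have [u [_ _ ue ui uA]] := lpath_fun hm.
by exists u, m; split=> // a b n h; apply: mx; exists a, b.
Qed.

Lemma cycle_ex : exists n, hascyc e setT n.
Proof.
have [|u [m [_ ue ui mx]]] := @longest_path_ex setT.
  by rewrite -card_gt0 cardsT; nat_lia.
have onpath y : e (u 0) y -> exists2 j, j <= m & y = u j.
  move=> ey; apply: NNPP => no; have : m.+1 <= m; last by rewrite ltnn.
  have h1 : lpath e (arc_set u 0 m) (u 0) (u (0 + m)) m.
    by apply: lpath_arc => // k km; apply: ue.
  apply: (mx y (u (0 + m))).
  apply: lpath_sub (subsetT ([set y] :|: arc_set u 0 m)).
  have := @lpath_cat _ _ [set y] _ y y _ _ 0 m _ h1; apply.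
  - by apply: lpath1; rewrite inE.
  - by rewrite disjoints1; apply/arc_setP => -[k km E]; apply: no; exists k.
  - by rewrite e_sym.
have [y [ey y0 y1]] := third_nbr no_2cut order_ge6 (u 0) (u 0) (u 1).
have [j jm yj] := onpath y ey.
have j2 : 1 < j.
  by case: j yj {jm} => [|[|j]] // yj; rewrite yj eqxx in y0 y1.
exists j.+1; apply: (hascyc_sub (A := arc_set u 0 j)); last exact: subsetT.
apply: (lpath_close (x := u 0) (y := u (0 + j))) => //.
  by apply: lpath_arc => [k kj|k l kj lj]; [apply: ue|apply: ui]; nat_lia.
by rewrite e_sym -yj.
Qed.

(** Without odd cycles, a shortest cycle has no chord, so some [y] off it can be prescribed in [H].
    Every vertex of the even cycle is attached, since a chord of even span closes an odd cycle. The
    parity forced on a path between antipodal vertices then makes the cycle through it odd. *)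
Lemma odd_cycle_ex : exists2 n, odd n & hascyc e setT n.
Proof.
apply: NNPP => no.
have evn A n : hascyc e A n -> ~~ odd n.
  move=> h; apply/negP => on; apply: no; exists n => //.
  exact: hascyc_sub h (subsetT _).
have [n [hn mn]] := ex_min cycle_ex.
have [v hv _] := (hascyc_fun _ _ _).1 hn.
have [y ey [yD|[d [d1 dn yd]]]] := off_cycle_or_chord 0 hv; last first.
  rewrite yd in ey; have [h _] := chord_cycles hv d1 dn ey.
  by have := mn _ (hascyc_sub h (subsetT _)); nat_lia.
have [|H [m [u mp]]] := max_pair_ex (@conn1 _ e y) hv (evn _ _ hn).
  by rewrite disjoint_sym disjoints1.
have [[hu om cH /subsetP yH dis] _] := mp.
have {}yH : y \in H by apply: yH; rewrite inE.
have H0 : H != set0 by apply/set0Pn; exists y.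
have [s E] : exists s, m = s.*2 by exists m./2; nat_lia.
rewrite {}E in mp hu om dis.
have att i : attached e H (u i).
  apply: NNPP => /(unattached_chord e_sym e_irr no_2cut order_ge6 mp H0)[d [d1 dn ed]].
  have od := chord_even e_sym no_2cut order_ge6 mp H0 d1 dn ed.
  have [/evn] := chord_cycles hu d1 dn ed.
  by rewrite /= od.
have [x xH ex] := att 0; have [x' xH' ex'] := att (0 + s.-1).
have [p hp] := cH _ _ xH xH'.
have op := antipodal_parity e_sym order_ge6 no_win mp H0 hp ex ex'.
have s2 : 1 < s by case: hu; nat_lia.
have sn : s.-1 < s.*2 by nat_lia.
have sp : 0 < s.-1 + p by nat_lia.
have /evn := theta e_sym hu hp dis ex ex' sn sp.
by rewrite /= negbK oddD op -subn1 oddB ?(ltnW s2) //; case: (odd s).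
Qed.

End OddCycle.

(** * Arithmetic of arcs on an odd cycle *)

Definition dist (a b : nat) := (a - b) + (b - a).

Lemma distC a b : dist a b = dist b a.
Proof. exact: addnC. Qed.

Lemma dist_alt a b d : dist a b = d -> a = b + d \/ b = a + d.
Proof. rewrite /dist; lia. Qed.

Lemma dist_cases a b o N : dist a b = o \/ dist a b = N - o ->
  a = b + o \/ b = a + o \/ a = b + (N - o) \/ b = a + (N - o).
Proof. by case=> /dist_alt; tauto. Qed.

(** Two steps of length 1 displace by 0 or 2; matching 4 up to sign, [N] would divide 2, 4 or 6. In
    [long_arcs_not_2] it would divide 2, 4 or 8. *)
Lemma short_arcs_not_4 N a b c : odd N -> 4 < N -> a < N -> b < N -> c < N ->
  dist a b = 1 \/ dist a b = N - 1 -> dist b c = 1 \/ dist b c = N - 1 ->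
  dist a c = 4 \/ dist a c = N - 4 -> False.
Proof.
move=> oN N5 an bn cn /dist_cases E1 /dist_cases E2 /dist_cases E3; lia.
Qed.

Lemma long_arcs_not_2 N a b c : odd N -> 4 < N -> a < N -> b < N -> c < N ->
  dist a b = 3 \/ dist a b = N - 3 -> dist b c = 3 \/ dist b c = N - 3 ->
  dist a c = 2 \/ dist a c = N - 2 -> False.
Proof.
move=> oN N5 an bn cn /dist_cases E1 /dist_cases E2 /dist_cases E3; lia.
Qed.

(** As [N] is odd, exactly one of the two arcs has even length. *)
Definition even_arc N a c := if odd (dist a c) then N - dist a c else dist a c.

Definition consecutive N a c :=
  a = c + 1 \/ c = a + 1 \/ a + N = c + 1 \/ c + N = a + 1.

Lemma even_arcE N a c : odd N -> a < N -> c < N ->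
  exists g, even_arc N a c = g.*2 /\ g.*2 < N /\
    (a = c + g.*2 \/ c = a + g.*2 \/ a + N = c + g.*2 \/ c + N = a + g.*2).
Proof.
move=> oN an cn; rewrite /even_arc.
have dN : dist a c < N by rewrite /dist; lia.
exists (if odd (dist a c) then (N - dist a c)./2 else (dist a c)./2).
have := @dist_alt a c _ erefl; move: (dist a c) dN => d dN.
have [od|od] := boolP (odd d); lia.
Qed.

(** Moving one end by two changes the even arc by 2, unless it would grow from [N - 1] to [N + 1];
    then [c] is the midpoint between [a] and [b]. *)
Lemma even_arc_diff N a b c : odd N -> 2 < N -> a < N -> b < N -> c < N ->
  dist a b = 2 \/ dist a b = N - 2 ->
  even_arc N a c = even_arc N b c + 2 \/ even_arc N b c = even_arc N a c + 2 \/
  consecutive N a c /\ consecutive N b c.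
Proof.
move=> oN N2 an bn cn /dist_cases Eab.
have [k Ek] : exists k, N = k.*2.+1 by exists N./2; lia.
have [g [-> [gN Eg]]] := @even_arcE N a c oN an cn.
have [h [-> [hN Eh]]] := @even_arcE N b c oN bn cn.
rewrite /consecutive; case: Eab => [|[|[|]]] Eab; lia.
Qed.

(** Indices at cyclic distance 2 have two common neighbours only on a 4-cycle. *)
Lemma midpoint_uniq N a b c d : odd N -> 2 < N -> a < N -> b < N -> c < N ->
  d < N -> dist a b = 2 \/ dist a b = N - 2 -> dist c d = 2 \/ dist c d = N - 2 ->
  consecutive N a c -> consecutive N b c ->
  consecutive N a d -> consecutive N b d -> False.
Proof.
rewrite /consecutive => oN N2 an bn cn dn /dist_cases Eab /dist_cases Ecd; lia.
Qed.

Lemma not_consecutive N a c : odd N -> 4 < N -> a < N -> c < N ->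
  dist a c = 2 \/ dist a c = N - 2 -> consecutive N a c -> False.
Proof. rewrite /consecutive => oN N2 an cn /dist_cases; lia. Qed.

(** Three steps of 2 with signs add up to 2 or 6, which no odd [N] above 4 divides. *)
Lemma no_dist2_triple N a b c : odd N -> 4 < N -> a < N -> b < N -> c < N ->
  dist a b = 2 \/ dist a b = N - 2 -> dist b c = 2 \/ dist b c = N - 2 ->
  dist a c = 2 \/ dist a c = N - 2 -> False.
Proof.
move=> oN N5 an bn cn /dist_cases E1 /dist_cases E2 /dist_cases E3; lia.
Qed.

Lemma theta_dist (T : finType) (e : rel T) n z (A : {set T}) x y a b p :
  symmetric e -> is_cyc e n z -> lpath e A x y p -> [disjoint cset n z & A] ->
  a < n -> b < n -> e x (z a) -> e y (z b) ->
  (0 < dist a b + p -> hascyc e (cset n z :|: A) (dist a b + p).+2) /\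
  (0 < dist a b -> hascyc e (cset n z :|: A) (n - dist a b + p).+2).
Proof.
move=> e_sym hz hp dis.
wlog ab : x y a b hp / a <= b.
  move=> hw an bn ex ey; have [ab|/ltnW ba] := leqP a b; first exact: hw hp ab an bn ex ey.
  have := hw y x b a (lpath_rev e_sym hp) ba bn an ey ex => -[h1 h2].
  by rewrite distC; split.
have -> : dist a b = b - a by rewrite /dist; lia.
move=> an bn; rewrite e_sym => ex; rewrite e_sym -(subnKC ab) => ey.
have sub i d : arc_set z i d :|: A \subset cset n z :|: A.
  by apply: setSU; apply: arc_set_sub => k; apply: mem_cset hz.
rewrite subnKC //; split=> h.
  by apply: hascyc_sub (sub _ _); apply: (theta e_sym hz hp dis ex ey) => //; lia.
apply: hascyc_sub (sub _ _); apply: (theta_compl e_sym hz hp dis ex ey); lia.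
Qed.

(* Two attachments of [K] would close an even cycle avoiding the odd cycle [w]. *)
Lemma attach_uniq (T : finType) (e : rel T) N z M w (K : {set T}) c c' x y :
  symmetric e -> irreflexive e -> has_no_2cut e -> 6 <= #|T| ->
  ~ has_consecutive_even_cycles e ->
  is_cyc e N z -> odd N -> is_cyc e M w -> odd M ->
  [disjoint cset N z & cset M w] -> conn e K ->
  [disjoint cset N z & K] -> [disjoint cset M w & K] ->
  c \in cset N z -> c' \in cset N z -> x \in K -> y \in K ->
  e x c -> e y c' -> c = c'.
Proof.
move=> e_sym e_irr cut n6 no_win hz oN hw oM dzw cK dzK dwK.
move=> /(csetP _ hz)[a an ->] /(csetP _ hz)[b bn ->] xK yK ex ey.
have [->//|ab] := eqVneq a b; have dab : 0 < dist a b by rewrite /dist; nat_lia.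
have dN : dist a b < N by rewrite /dist; nat_lia.
have [p hp] := cK _ _ xK yK.
have [h1 h2] := theta_dist e_sym hz hp dzK an bn ex ey.
have {}h1 := h1 (ltn_addr _ dab); have {}h2 := h2 dab.
have dis : [disjoint cset M w & cset N z :|: K].
  by rewrite disjoint_sym disjoint_setUl dzw disjoint_sym.
have meet := even_meets_odd e_sym e_irr cut n6 no_win hw oM.
suff : ~~ [disjoint cset M w & cset N z :|: K] by rewrite dis.
have [od|od] := boolP (odd (dist a b + p)); last first.
  by apply: (meet _ _ h1); rewrite /= negbK.
apply: (meet _ _ h2).
by rewrite /= negbK oddD oddB ?(ltnW dN) // oN -addbA -oddD od.
Qed.

(** * Shortest odd cycles *)

Section ShortestOddCycle.

Variables (T : finType) (e : rel T).
Hypotheses (e_sym : symmetric e) (e_irr : irreflexive e).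
Hypotheses (no_2cut : has_no_2cut e) (order_ge6 : 6 <= #|T|).
Hypothesis no_win : ~ has_consecutive_even_cycles e.
Variables (N : nat) (z : nat -> T).
Hypotheses (hz : is_cyc e N z) (oN : odd N).
Hypothesis z_short : forall A n, hascyc e A n -> odd n -> N <= n.

Implicit Types (A B H K Q : {set T}).

Local Notation Z := (cset N z).

Let N_gt2 : 2 < N. Proof. by case: hz. Qed.

Lemma Z_P x : x \in Z -> exists2 a, a < N & x = z a.
Proof. by move/(csetP _ hz). Qed.

Lemma zZ a : z a \in Z.
Proof. exact: mem_cset hz. Qed.

Lemma z_inj a b : a < N -> b < N -> a != b -> z a != z b.
Proof. by case: hz => _ _ _ inj an bn; apply: contraNneq => /inj ->. Qed.

Lemma z_adj a b : N = 3 -> a < N -> b < N -> a != b -> e (z a) (z b).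
Proof.
move=> N3 an bn ab; have [/eqP E|/eqP E] : b = a.+1 %[mod N] \/ a = b.+1 %[mod N].
- rewrite N3 in an bn *.
  case: a b an bn ab => [|[|[|//]]] [|[|[|//]]] //= _ _ _; first [by left | by right].
- by apply: (cyc_edge_mod hz); apply/eqP.
by rewrite e_sym; apply: (cyc_edge_mod hz); apply/eqP.
Qed.

Lemma card_Z_gt2 : 2 < #|Z|.
Proof. by rewrite (card_cset hz). Qed.

Lemma off_even_odd A n : hascyc e A n -> [disjoint Z & A] -> odd n.
Proof.
move=> hA; apply: contraTT => on.
exact: (even_meets_odd e_sym e_irr no_2cut order_ge6 no_win hz oN hA on).
Qed.

Lemma disZC : [disjoint Z & ~: Z].
Proof. by rewrite disjoint_sym disjoints_subset. Qed.

Lemma no_two_lengths n A B : ~~ odd n -> hascyc e A n -> hascyc e B n.+2 -> False.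
Proof. by move=> on hA hB; apply: (no_two_cycles no_win on hA hB). Qed.

Lemma thetaZ x y a b p : lpath e (~: Z) x y p -> a < N -> b < N ->
  e x (z a) -> e y (z b) ->
  (0 < dist a b + p -> hascyc e setT (dist a b + p).+2) /\
  (0 < dist a b -> hascyc e setT (N - dist a b + p).+2).
Proof.
move=> hp an bn ex ey; have [h1 h2] := theta_dist e_sym hz hp disZC an bn ex ey.
by split=> h; apply: hascyc_sub (subsetT _); [apply: h1|apply: h2].
Qed.

(* By minimality of [Z], for [N >= 5] the odd arcs from [a] to [b] and from [b] to
   [c] have length 1 or 3, and the even arc from [a] to [c] has length 2 or 4. *)
Lemma local_path x y w a b c : x \notin Z -> y \notin Z -> w \notin Z ->
  e x y -> e y w -> x != w -> a < N -> b < N -> c < N -> a != c ->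
  e x (z a) -> e y (z b) -> e w (z c) -> False.
Proof.
move=> xZ yZ wZ exy eyw xw an bn cn ac exa eyb ewc.
have xy := edge_neq e_irr exy; have yw := edge_neq e_irr eyw.
have hxy : lpath e (~: Z) x y 1 by apply: lpath_edge; rewrite ?in_setC.
have hyw : lpath e (~: Z) y w 1 by apply: lpath_edge; rewrite ?in_setC.
have hxw : lpath e (~: Z) x w 2.
  exists [:: y; w]; split=> //=; rewrite ?exy ?eyw // ?inE ?negb_or ?xy ?xw ?yw //.
  by move=> t; rewrite in_setC !in_cons orbF => /or3P[]/eqP ->.
have [xy1 xy2] := thetaZ hxy an bn exa eyb.
have [yw1 yw2] := thetaZ hyw bn cn eyb ewc.
have [xw1 xw2] := thetaZ hxw an cn exa ewc.
have d3 : 0 < dist a c by rewrite /dist; clear -ac; lia.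
have {}xy1 := xy1 (leq_addl _ 1); have {}yw1 := yw1 (leq_addl _ 1).
have {}xw1 := xw1 (ltnW (leq_addl _ 2)); have {}xw2 := xw2 d3.
have win n := @no_two_lengths n setT setT.
have short n : hascyc e setT n -> odd n -> N <= n by apply: z_short.
(* Arcs of a triangle have lengths 1 and 2: the path of length 2 with an arc of length 2 gives a
   6-cycle, and an edge with an arc of length 1 gives a 4-cycle. *)
have [N3|N3] := eqVneq N 3.
  have c6 : hascyc e setT 6.
    have [E|E] : dist a c = 1 \/ dist a c = 2 by rewrite /dist; clear -ac an cn N3; lia.
      by rewrite N3 E in xw2.
    by rewrite E in xw1.
  apply: (win 4) => //.
  have [E|E] : 0 < dist a b \/ 0 < dist b c by rewrite /dist; clear -ac; lia.
    have {}xy2 := xy2 E.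
    have [E'|E'] : dist a b = 1 \/ dist a b = 2 by rewrite /dist in E *; clear -E an bn N3; lia.
      by rewrite E' in xy1.
    by rewrite N3 E' in xy2.
  have {}yw2 := yw2 E.
  have [E'|E'] : dist b c = 1 \/ dist b c = 2 by rewrite /dist in E *; clear -E cn bn N3; lia.
    by rewrite E' in yw1.
  by rewrite N3 E' in yw2.
have N5 : 4 < N by clear -N3 N_gt2 oN; lia.
(* At distance 0 the edge would close a triangle, shorter than [N]. *)
have pos d : hascyc e setT (d + 1).+2 -> 0 < d.
  case: d => // h; have := short _ h isT; clear -N5; lia.
(* Through the even arc the edge closes an odd cycle of length [N - o + 3], so [o <= 3] by
   minimality. *)
have step d : d < N -> hascyc e setT (d + 1).+2 -> hascyc e setT (N - d + 1).+2 ->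
    exists o, [/\ hascyc e setT (o + 3), o = 1 \/ o = 3 & d = o \/ d = N - o].
  move=> dN h1 h2; have d0 := pos _ h1; have [od|od] := boolP (odd d).
    exists d; split; [by rewrite addn3; rewrite addn1 in h1| |by left].
    have := short _ h2; clear -od dN N5 oN d0.
    by rewrite /= negbK oddD oddB ?(ltnW dN) // oN od /= => /(_ isT); lia.
  exists (N - d); split; [by rewrite addn3; rewrite addn1 in h2| |right; clear -dN; lia].
  have := short _ h1; rewrite /= negbK oddD (negbTE od) /= => /(_ isT).
  clear -od dN N5 oN d0; lia.
have dab : dist a b < N by rewrite /dist; clear -an bn; lia.
have dbc : dist b c < N by rewrite /dist; clear -cn bn; lia.
have [o1 [C1 o13 E1]] := step _ dab xy1 (xy2 (pos _ xy1)).
have [o2 [C2 o23 E2]] := step _ dbc yw1 (yw2 (pos _ yw1)).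
have [f [C3 f24 E3]] : exists f, [/\ hascyc e setT (f + 4), f = 2 \/ f = 4
    & dist a c = f \/ dist a c = N - f].
  have dac : dist a c < N by rewrite /dist; clear -an cn; lia.
  move: (dist a c) xw1 xw2 d3 dac => d h1 h2 d0 dN.
  have [od|od] := boolP (odd d).
    exists (N - d); split; [by rewrite addn4; rewrite addn2 in h2| |right; clear -dN; lia].
    have := short _ h1; rewrite /= negbK oddD od /= => /(_ isT).
    clear -od dN N5 oN d0; lia.
  exists d; split; [by rewrite addn4; rewrite addn2 in h1| |by left].
  have := short _ h2; rewrite /= negbK oddD oddB ?(ltnW dN) // oN (negbTE od) /= => /(_ isT).
  clear -od dN N5 oN d0; lia.
(* The even lengths are [o1 + 3] and [o2 + 3], each 4 or 6, and [f + 4], which is 6 or 8. Only 4, 4,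
   8 and 6, 6, 6 contain no consecutive pair, and arc arithmetic excludes these. *)
case: o13 o23 f24 C1 C2 C3 E1 E2 E3 => -> [] -> [] -> C1 C2 C3 E1 E2 E3.
- exact: (win 4).
- by case: (short_arcs_not_4 oN N5 an bn cn E1 E2 E3).
- exact: (win 4).
- exact: (win 4).
- exact: (win 4).
- exact: (win 4).
- by case: (long_arcs_not_2 oN N5 an bn cn E1 E2 E3).
- exact: (win 6).
Qed.

(** * An odd cycle disjoint from the shortest one *)

Section DisjointOddCycle.

Variables (M : nat) (w : nat -> T).
Hypotheses (hw : is_cyc e M w) (dzw : [disjoint Z & cset M w]).

Local Notation W := (cset M w).

Let oM : odd M.
Proof.
apply: (off_even_odd (A := W)) => //; apply/hascyc_fun; exists w => // i.
exact: mem_cset hw.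
Qed.

Lemma two_cycles_cover : Z :|: W = setT.
Proof.
apply/setP=> u; rewrite in_setT; apply/negPn/negP => uZW.
have [|K [KZW cK uK Kcl]] := @component_ex _ _ e_sym (~: (Z :|: W)) u.
  by rewrite in_setC.
have dKZW : [disjoint K & Z :|: W] by rewrite disjoints_subset.
have dzK : [disjoint Z & K].
  by rewrite disjoint_sym; apply: disjointWr dKZW; apply: subsetUl.
have dwK : [disjoint W & K].
  by rewrite disjoint_sym; apply: disjointWr dKZW; apply: subsetUr.
have NK y : y \in nbrs e K -> y \in Z \/ y \in W.
  case/nbrsP=> yK [x xK exy]; apply/orP; rewrite -in_setU.
  by apply: contraNT yK => yZW; apply: (Kcl x) => //; rewrite in_setC.
have one (Y : {set T}) : (forall c c', c \in Y -> c' \in Y -> c \in nbrs e K ->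
    c' \in nbrs e K -> c = c') ->
    exists c, forall c', c' \in Y -> c' \in nbrs e K -> c' = c.
  move=> uniqY; have [[c [cY cN]]|no] := classic (exists c, c \in Y /\ c \in nbrs e K).
    by exists c => c' c'Y c'N; apply: uniqY.
  by exists u => c' c'Y c'N; case: no; exists c'.
have [|c1 hc1] := one Z.
  move=> c c' cZ c'Z /nbrsP[_ [x xK ex]] /nbrsP[_ [y yK ey]].
  exact: (attach_uniq e_sym e_irr no_2cut order_ge6 no_win hz oN hw oM dzw cK
    dzK dwK cZ c'Z xK yK ex ey).
have [|c2 hc2] := one W.
  move=> c c' cW c'W /nbrsP[_ [x xK ex]] /nbrsP[_ [y yK ey]].
  have dwz : [disjoint W & Z] by rewrite disjoint_sym.
  exact: (attach_uniq e_sym e_irr no_2cut order_ge6 no_win hw oM hz oN dwz cK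
    dwK dzK cW c'W xK yK ex ey).
have sub : nbrs e K \subset [set c1; c2].
  apply/subsetP=> y yN; rewrite !inE.
  by case: (NK y yN) => [/hc1|/hc2] => ->; rewrite ?eqxx ?orbT.
have K0 : K != set0 by apply/set0Pn; exists u.
have := no_2cut K0; rewrite (leq_trans (subset_leq_card sub)); last first.
  by rewrite cards2; case: (_ != _).
move/(_ isT) => E; have [t tZ [tc1 _]] := card_gt2_avoid c1 c1 card_Z_gt2.
have := in_setT t; rewrite -E in_setU (disjointFr dzK tZ) /= => /(hc1 _ tZ) tc.
by rewrite tc eqxx in tc1.
Qed.

(** A chord would split the odd cycle [w] into two cycles of total length [M + 2], one of them even
    and disjoint from [Z]. *)
Lemma W_attached i : exists2 a, a < N & e (w i) (z a).
Proof.
have [y ey [yW|[d [d1 dn yd]]]] := off_cycle_or_chord e_irr no_2cut order_ge6 i hw.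
  have := in_setT y; rewrite -two_cycles_cover in_setU (negbTE yW) orbF.
  by move/Z_P => [a an ya]; exists a => //; rewrite -ya.
rewrite yd in ey; have [h1 h2] := chord_cycles e_sym order_ge6 hw d1 dn ey.
have := off_even_odd h1 dzw; have := off_even_odd h2 dzw.
rewrite /= oddB ?oM; last by nat_lia.
by case: (odd d).
Qed.

(** Steps of two run through all of the odd cycle [w]. If they never changed the attachment, [z c0]
    would be a cut vertex. *)
Lemma W_two_step : exists i a c, [/\ a < N, c < N, a != c, e (w i) (z a)
  & e (w (i + 2)) (z c)].
Proof.
apply: NNPP => no; have [c0 c0N ec0] := W_attached 0.
have const k a : a < N -> e (w k.*2) (z a) -> a = c0.
  elim: k a => [|k IH] a an ea.
    have [c cN ec] := W_attached 2.
    have uniq b : b < N -> e (w 0) (z b) -> b = c.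
      move=> bN eb; apply/eqP/negPn/negP => nb; apply: no.
      by exists 0, b, c.
    by rewrite (uniq a an ea) (uniq c0 c0N ec0).
  have [b bN eb] := W_attached k.*2; have E := IH b bN eb.
  rewrite -E; apply/eqP/negPn/negP => nab; apply: no.
  by exists k.*2, b, a; split=> //; rewrite 1?eq_sym // addn2 -doubleS.
have sub : nbrs e W \subset [set z c0].
  apply/subsetP => y /nbrsP[yW [x xW exy]].
  have [i iM xi] := csetP _ hw xW.
  have [k xk] : exists k, x = w k.*2.
    have [oi|ei] := boolP (odd i).
      exists (i + M)./2; have -> : (i + M)./2.*2 = i + M by nat_lia.
      by have [_ _ -> _] := hw.
    by exists i./2; have -> : i./2.*2 = i by nat_lia.
  have := in_setT y; rewrite -two_cycles_cover in_setU (negbTE yW) orbF.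
  move/Z_P => [a an ya]; rewrite inE ya (const k a an) //.
  by rewrite -xk -ya.
have W0 : W != set0 by apply/set0Pn; exists (w 0); apply: mem_cset hw.
have := no_2cut W0; rewrite (leq_trans (subset_leq_card sub)) ?cards1 //.
move/(_ isT) => E; have [t tZ [tc _]] := card_gt2_avoid (z c0) (z c0) card_Z_gt2.
have := in_setT t; rewrite -E in_setU (disjointFr dzw tZ) /= => /(subsetP sub).
by rewrite inE (negbTE tc).
Qed.

Lemma disjoint_cycle_absurd : False.
Proof.
have [i [a [c [an cn ac ea ec]]]] := W_two_step.
have [b bn eb] := W_attached i.+1.
have nZ j : w j \notin Z by rewrite (disjointFl dzw) // (mem_cset _ hw).
have [M2 we _ _] := hw.
apply: (@local_path (w i) (w i.+1) (w (i + 2)) a b c) => //.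
  by rewrite addn2.
apply/eqP; rewrite -[in LHS](addn0 i) => /(cyc_inj hw)/eqP.
by rewrite eqn_modDl => /eqP; rewrite mod0n modn_small.
Qed.

End DisjointOddCycle.

Lemma no_disjoint_cycle A n : hascyc e A n -> ~~ [disjoint Z & A].
Proof.
move=> /hascyc_fun[w hw wA]; apply/negP => dis.
apply: (disjoint_cycle_absurd hw); apply: disjointWr dis.
exact: arc_set_sub.
Qed.

(** * Vertices with two neighbours on the shortest odd cycle *)

Definition rich x := exists a b,
  [/\ a < N, b < N, a != b, e x (z a) & e x (z b)].

Lemma rich_leaf x q : (forall y, y \notin Z -> e x y -> y = q) -> rich x.
Proof.
move=> leaf; have N2 := card_nbrs1 no_2cut order_ge6 x.
have inZ y : y \in nbrs e [set x] -> y != q -> exists2 a, a < N & y = z a /\ e x (z a).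
  case/nbrsP=> _ [t]; rewrite inE => /eqP -> ey yq.
  have yZ : y \in Z by apply: contraNT yq => yZ; rewrite (leaf y yZ ey).
  by have [a an ya] := Z_P yZ; exists a => //; rewrite -ya.
have [y1 y1N [y1q _]] := card_gt2_avoid q q N2.
have [y2 y2N [y2q y21]] := card_gt2_avoid q y1 N2.
have [a an [Ea ea]] := inZ _ y1N y1q; have [b bn [Eb eb]] := inZ _ y2N y2q.
by exists a, b; split=> //; apply: contraNneq y21 => ab; rewrite Ea Eb ab.
Qed.

Lemma attached_degree2 x q r : (forall y, y \notin Z -> e x y -> y = q \/ y = r) ->
  exists2 a, a < N & e x (z a).
Proof.
move=> two; have [y [ey yq yr]] := third_nbr no_2cut order_ge6 x q r.
have yZ : y \in Z.
  by apply: contraNT yq => yZ; case: (two y yZ ey) => E; rewrite E ?eqxx // E eqxx in yr *.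
by have [a an ya] := Z_P yZ; exists a => //; rewrite -ya.
Qed.

(** The odd arc between the two neighbours closes an odd cycle through [x], so by minimality the
    even arc has length at most 2. *)
Lemma rich_dist x a b : x \notin Z -> a < N -> b < N -> a != b ->
  e x (z a) -> e x (z b) -> dist a b = 2 \/ dist a b = N - 2.
Proof.
move=> xZ an bn ab ea eb.
have hx : lpath e (~: Z) x x 0 by apply: lpath1; rewrite in_setC.
have dab : 0 < dist a b by rewrite /dist; nat_lia.
have dN : dist a b < N by rewrite /dist; nat_lia.
have [h1 h2] := thetaZ hx an bn ea eb.
have {}h1 := z_short (h1 (ltn_addr _ dab)); have {}h2 := z_short (h2 dab).
move: (dist a b) dab dN h1 h2 => d d0 dN; rewrite !addn0 /= !negbK.
clear -d0 dN oN N_gt2; have [od|od] := boolP (odd d) => h1 h2.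
  by have := h1 isT; lia.
by have := h2 ltac:(by rewrite oddB ?(ltnW dN) // oN (negbTE od)); lia.
Qed.

Lemma even_arc_cyc x y p a c : lpath e (~: Z) x y p -> ~~ odd p -> 0 < p ->
  a < N -> c < N -> e x (z a) -> e y (z c) ->
  hascyc e setT (even_arc N a c + p).+2 /\ ~~ odd (even_arc N a c + p).
Proof.
move=> hp op p0 an cn ea ec; have [h1 h2] := thetaZ hp an cn ea ec.
have dN : dist a c < N by rewrite /dist; nat_lia.
rewrite /even_arc; have [od|od] := boolP (odd (dist a c)); split.
- by apply: h2; case: (dist a c) od.
- by rewrite oddD oddB ?(ltnW dN) // oN od.
- by apply: h1; rewrite addn_gt0 p0 orbT.
- by rewrite oddD (negbTE od).
Qed.

Lemma odd_arc_cyc x y a c : x \notin Z -> y \notin Z -> e x y ->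
  a < N -> c < N -> a != c -> e x (z a) -> e y (z c) ->
  hascyc e setT (N - even_arc N a c + 1).+2 /\ ~~ odd (N - even_arc N a c + 1).
Proof.
move=> xZ yZ exy an cn ac ea ec.
have hp : lpath e (~: Z) x y 1.
  by apply: lpath_edge; rewrite ?in_setC //; apply: (edge_neq e_irr).
have [h1 h2] := thetaZ hp an cn ea ec.
have dN : dist a c < N by rewrite /dist; nat_lia.
have d0 : 0 < dist a c by rewrite /dist; nat_lia.
rewrite /even_arc; have [od|od] := boolP (odd (dist a c)).
  rewrite subKn ?(ltnW dN) //; split; last by rewrite oddD od.
  by apply: h1; rewrite addn1.
split; first exact: h2.
by rewrite oddD oddB ?(ltnW dN) // oN (negbTE od).
Qed.

(* The even arcs from two neighbours of [x] to a neighbour of [y] differ by 2 in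
   length, unless the latter is the midpoint of the former. *)
Lemma rich_even_path x y p : x \notin Z -> y \notin Z -> rich x -> rich y ->
  lpath e (~: Z) x y p -> 0 < p -> ~~ odd p -> False.
Proof.
move=> xZ yZ [a [b [an bn ab ea eb]]] [c [d [cn dn cd ec ed]]] hp p0 op.
have Dab := rich_dist xZ an bn ab ea eb; have Dcd := rich_dist yZ cn dn cd ec ed.
have win f : f < N -> e y (z f) -> even_arc N a f = even_arc N b f + 2 \/
    even_arc N b f = even_arc N a f + 2 -> False.
  move=> fn ef; have [ha oa] := even_arc_cyc hp op p0 an fn ea ef.
  have [hb ob] := even_arc_cyc hp op p0 bn fn eb ef.
  case=> E.
    by apply: (no_two_lengths _ hb (B := setT)); rewrite /= ?negbK //; rewrite E addn2 in ha.
  by apply: (no_two_lengths _ ha (B := setT)); rewrite /= ?negbK //; rewrite E addn2 in hb.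
have diff f (fn : f < N) := even_arc_diff oN N_gt2 an bn fn Dab.
(* At most one of the two neighbours of [y] can be the midpoint. *)
have [E|[E|[ac bc]]] := diff c cn; [by apply: (win c) => //; left|by apply: (win c) => //; right|].
have [E|[E|[ad bd]]] := diff d dn; [by apply: (win d) => //; left|by apply: (win d) => //; right|].
exact: (midpoint_uniq oN N_gt2 an bn cn dn Dab Dcd).
Qed.

(** The variant of [rich_even_path] with odd arcs, which close even cycles with the edge from [x] to
    [y]. An odd arc has distinct ends, hence the conditions on [f]. *)
Lemma rich_edge x y a b f : x \notin Z -> y \notin Z -> e x y ->
  a < N -> b < N -> a != b -> e x (z a) -> e x (z b) ->
  f < N -> f != a -> f != b -> e y (z f) -> consecutive N a f /\ consecutive N b f.
Proof.
move=> xZ yZ exy an bn ab ea eb fn fa fb ef.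
have Dab := rich_dist xZ an bn ab ea eb; rewrite eq_sym in fa; rewrite eq_sym in fb.
have [ha oa] := odd_arc_cyc xZ yZ exy an fn fa ea ef.
have [hb ob] := odd_arc_cyc xZ yZ exy bn fn fb eb ef.
have [E|[E|//]] := even_arc_diff oN N_gt2 an bn fn Dab; exfalso.
  have le : even_arc N b f + 2 <= N.
    by rewrite -E; have [h [-> [hN _]]] := even_arcE oN an fn; apply: ltnW.
  apply: (no_two_lengths _ ha (B := setT)); rewrite /= ?negbK //.
  have E' : N - even_arc N b f = (N - even_arc N a f).+2 by rewrite E; clear -le; lia.
  by rewrite E' in hb.
have le : even_arc N a f + 2 <= N.
  by rewrite -E; have [h [-> [hN _]]] := even_arcE oN bn fn; apply: ltnW.
apply: (no_two_lengths _ hb (B := setT)); rewrite /= ?negbK //.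
have E' : N - even_arc N a f = (N - even_arc N b f).+2 by rewrite E; clear -le; lia.
by rewrite E' in ha.
Qed.

(** * Longest paths in the forest off the cycle *)

Lemma acyclic A n : hascyc e A n -> A \subset ~: Z -> False.
Proof.
move=> hA AZ; have := no_disjoint_cycle hA.
by rewrite disjoint_sym disjoints_subset AZ.
Qed.

Definition maxpath (u : nat -> T) m : Prop :=
  [/\ forall k, k <= m -> u k \notin Z, forall k, k < m -> e (u k) (u k.+1),
      forall k l, k <= m -> l <= m -> u k = u l -> k = l
    & forall x y n, lpath e (~: Z) x y n -> n <= m].

Lemma maxpath_rev u m : maxpath u m -> maxpath (fun k => u (m - k)) m.
Proof.
move=> [uZ ue ui mx]; split=> // [k km|k km|k l km lm E].
- by apply: uZ; rewrite leq_subr.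
- have -> : m - k = (m - k.+1).+1 by nat_lia.
  by rewrite e_sym; apply: ue; nat_lia.
- by have := ui _ _ (leq_subr k m) (leq_subr l m) E; nat_lia.
Qed.

Section LongestPath.

Variables (u : nat -> T) (m : nat).
Hypothesis mp : maxpath u m.

Definition off_path q := forall k, k <= m -> q <> u k.

Lemma mp_sub i d : i + d <= m -> lpath e (arc_set u i d) (u i) (u (i + d)) d.
Proof.
have [uZ ue ui _] := mp => im; apply: lpath_arc => [k kd|k l kd ld E].
  by apply: ue; nat_lia.
by have := ui _ _ _ _ E; nat_lia.
Qed.

Lemma mp_arcZ i d : i + d <= m -> arc_set u i d \subset ~: Z.
Proof.
have [uZ _ _ _] := mp => im; apply/subsetP=> x /arc_setP[k kd ->].
by rewrite in_setC; apply: uZ; nat_lia.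
Qed.

Lemma off_disjoint q i d : off_path q -> i + d <= m ->
  [disjoint [set q] & arc_set u i d].
Proof.
move=> oq im; rewrite disjoints1; apply/arc_setP => -[k kd]; apply: oq.
by nat_lia.
Qed.

Lemma set1Z q : q \notin Z -> [set q] \subset ~: Z.
Proof. by rewrite sub1set in_setC. Qed.

Lemma lpath_set1 q : lpath e [set q] q q 0.
Proof. by apply: lpath1; rewrite inE. Qed.

Lemma path_chord i j : i < j <= m -> e (u i) (u j) -> j = i.+1.
Proof.
move=> /andP[ij jm] eij; apply/eqP/negPn/negP => ne.
have im : i + (j - i) <= m by nat_lia.
apply: (@acyclic (arc_set u i (j - i)) (j - i).+1 _ (mp_arcZ im)).
apply: (lpath_close (mp_sub im)); last by nat_lia.
by rewrite subnKC ?(ltnW ij) // e_sym.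
Qed.

Lemma hang1 q i j : q \notin Z -> off_path q -> i <= m -> j <= m ->
  e q (u i) -> e q (u j) -> i = j.
Proof.
move=> qZ oq; wlog ij : i j / i <= j.
  move=> hw im jm ei ej; have [ij|/ltnW ji] := leqP i j; first exact: hw.
  by apply/esym; apply: hw.
move=> im jm ei ej; apply/eqP/negPn/negP => ne.
have im' : i + (j - i) <= m by nat_lia.
apply: (@acyclic ([set q] :|: arc_set u i (j - i)) (0 + (j - i)).+2).
  apply: (lpath_glue (lpath_set1 q) (mp_sub im') (off_disjoint oq im') ei).
    by rewrite subnKC // e_sym.
  by nat_lia.
by rewrite subUset set1Z ?mp_arcZ.
Qed.

Lemma pair_disjoint q q' i d : off_path q -> off_path q' -> i + d <= m ->
  [disjoint [set q; q'] & arc_set u i d].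
Proof. by move=> oq oq' im; rewrite disjoint_setUl !off_disjoint. Qed.

Lemma hang_cycle q q' i j : q \notin Z -> q' \notin Z -> off_path q ->
  off_path q' -> e q q' -> i <= m -> j <= m -> e q (u i) -> e q' (u j) -> False.
Proof.
wlog ij : q q' i j / i <= j.
  move=> hw qZ q'Z oq oq' eqq im jm ei ej; have [ij|/ltnW ji] := leqP i j.
    exact: (hw q q' i j).
  by apply: (hw q' q j i) => //; rewrite e_sym.
move=> qZ q'Z oq oq' eqq im jm ei ej.
have im' : i + (j - i) <= m by nat_lia.
have hq : lpath e [set q; q'] q' q 1.
  apply: lpath_edge; rewrite ?inE ?eqxx ?orbT 1?e_sym //.
  by rewrite eq_sym; apply: edge_neq eqq.
apply: (@acyclic ([set q; q'] :|: arc_set u i (j - i)) (1 + (j - i)).+2).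
  apply: (lpath_glue hq (mp_sub im') (pair_disjoint oq oq' im') ei) => //.
  by rewrite subnKC // e_sym.
by rewrite !subUset !set1Z ?mp_arcZ.
Qed.

(** This and the next two lemmas bound side branches: a branch at [u i] of depth more than [i],
    continued to [u m], would beat the longest path. *)
Lemma hang_length1 q i : q \notin Z -> off_path q -> i <= m -> e q (u i) ->
  lpath e (~: Z) q (u m) (m - i).+1.
Proof.
move=> qZ oq im ei; have im' : i + (m - i) <= m by nat_lia.
have := lpath_cat (lpath_set1 q) (mp_sub im') (off_disjoint oq im') ei.
rewrite add0n subnKC // => h; apply: lpath_sub h _.
by rewrite subUset set1Z ?mp_arcZ.
Qed.

Lemma hang_length2 q r i : q \notin Z -> r \notin Z -> off_path q -> off_path r ->
  i <= m -> e r q -> e q (u i) -> lpath e (~: Z) r (u m) (m - i).+2.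
Proof.
move=> qZ rZ oq or im er ei; have im' : i + (m - i) <= m by nat_lia.
have h2 : lpath e [set r; q] r q 1.
  by apply: lpath_edge; rewrite ?inE ?eqxx ?orbT //; apply: edge_neq er.
have := lpath_cat h2 (mp_sub im') (pair_disjoint or oq im') ei.
rewrite add1n subnKC // => h; apply: lpath_sub h _.
by rewrite !subUset !set1Z ?mp_arcZ.
Qed.

Lemma hang_length3 q r t i : q \notin Z -> r \notin Z -> t \notin Z ->
  off_path q -> off_path r -> off_path t -> t != q ->
  i <= m -> e t r -> e r q -> e q (u i) -> lpath e (~: Z) t (u m) (m - i).+3.
Proof.
move=> qZ rZ tZ oq or ot tq im et er ei; have im' : i + (m - i) <= m by nat_lia.
have h2 : lpath e [set r; q] r q 1.
  by apply: lpath_edge; rewrite ?inE ?eqxx ?orbT //; apply: edge_neq er.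
have dt : [disjoint [set t] & [set r; q]].
  by rewrite disjoints1 !inE negb_or tq andbT; apply: edge_neq et.
have h3 := lpath_cat (lpath_set1 t) h2 dt et.
have d3 : [disjoint [set t] :|: [set r; q] & arc_set u i (m - i)].
  by rewrite disjoint_setUl off_disjoint ?pair_disjoint.
have := lpath_cat h3 (mp_sub im') d3 ei.
rewrite subnKC // => h; apply: lpath_sub h _.
by rewrite !subUset !set1Z ?mp_arcZ.
Qed.

Lemma on_or_off q : off_path q \/ exists2 k, k <= m & q = u k.
Proof.
have [?|no] := classic (exists2 k, k <= m & q = u k); [by right|left].
by move=> k km E; apply: no; exists k.
Qed.

Lemma start_leaf y : y \notin Z -> e (u 0) y -> y = u 1.
Proof.
have [_ _ _ mx] := mp; move=> yZ ey; have [oy|[j jm yj]] := on_or_off y.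
  rewrite e_sym in ey; have := mx _ _ _ (hang_length1 yZ oy (leq0n m) ey).
  by rewrite subn0 ltnn.
rewrite yj in ey *; case: j jm ey {yj} => [|j] jm ey; first by rewrite e_irr in ey.
by rewrite (path_chord _ ey).
Qed.

Lemma rich_start : rich (u 0).
Proof. by apply: (@rich_leaf _ (u 1)) => y; apply: start_leaf. Qed.

End LongestPath.

Lemma rich_end u m : maxpath u m -> rich (u m).
Proof. by move=> /maxpath_rev/rich_start; rewrite subn0. Qed.

(** Both ends are leaves, hence rich, and no path of positive even length joins rich vertices. *)
Lemma maxpath_odd u m : maxpath u m -> 0 < m -> odd m.
Proof.
move=> mp m0; apply/negPn/negP => om; have [uZ _ _ _] := mp.
have m0' : 0 + m <= m by rewrite add0n.
apply: (rich_even_path (uZ 0 (leq0n m)) (uZ m (leqnn m)) (rich_start mp)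
  (rich_end mp) (lpath_sub (mp_sub mp m0') (mp_arcZ mp m0')) m0 om).
Qed.

(** A further neighbour [q] of [u 1] is a leaf, as deeper branches are too long; so [u 0], [u 1],
    [q] would be an even path between rich vertices. *)
Lemma second_vertex u m q : maxpath u m -> 1 < m -> q \notin Z -> e (u 1) q ->
  q = u 0 \/ q = u 2.
Proof.
move=> mp m1 qZ eq; have [uZ ue ui mx] := mp.
have [oq|[j jm qj]] := on_or_off u m q; last first.
  rewrite qj in eq *; case: j jm eq {qj} => [|[|j]] jm eq; [by left| |right].
    by rewrite e_irr in eq.
  by rewrite (path_chord mp _ eq).
exfalso; rewrite e_sym in eq.
have rq : rich q.
  apply: (@rich_leaf _ (u 1)) => r rZ er.
  have [or|[j jm rj]] := on_or_off u m r.
    rewrite e_sym in er.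
    by have := mx _ _ _ (hang_length2 mp qZ rZ oq or (ltnW m1) er eq); nat_lia.
  by rewrite rj; rewrite rj in er; rewrite (hang1 mp qZ oq jm (ltnW m1) er eq).
have m1' : 0 + 1 <= m by nat_lia.
have dq := off_disjoint oq m1'; rewrite disjoint_sym in dq; rewrite e_sym in eq.
have h := lpath_cat (mp_sub mp m1') (lpath_set1 q) dq eq.
apply: (rich_even_path (uZ 0 (leq0n m)) qZ (rich_start mp) rq (lpath_sub h _)) => //.
by rewrite subUset set1Z ?(mp_arcZ mp).
Qed.

(** A further neighbour [q] of [u 2] is either a leaf, joined to [u m] by a path of even length
    [m - 1], or leads to a leaf [q'], joined to [u 0] by a path of length 4. *)
Lemma third_vertex u m q : maxpath u m -> 2 < m -> q \notin Z -> e (u 2) q ->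
  q = u 1 \/ q = u 3.
Proof.
move=> mp m2 qZ eq; have [uZ ue ui mx] := mp.
have om : odd m by apply: (maxpath_odd mp); nat_lia.
have [oq|[j jm qj]] := on_or_off u m q; last first.
  rewrite qj in eq *; case: j jm eq {qj} => [|[|[|j]]] jm eq.
  - by rewrite e_sym in eq; have := path_chord mp _ eq; rewrite (ltnW m2) => /(_ isT).
  - by left.
  - by rewrite e_irr in eq.
  - by right; rewrite (path_chord mp _ eq).
exfalso; rewrite e_sym in eq.
have [[q' [q'Z eqq q'2]]|leaf] := classic (exists q', [/\ q' \notin Z, e q q' & q' != u 2]);
  last first.
  have rq : rich q.
    apply: (@rich_leaf _ (u 2)) => r rZ er; apply/eqP/negPn/negP => nr.
    by apply: leaf; exists r.
  apply: (rich_even_path qZ (uZ m (leqnn m)) rq (rich_end mp)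
    (hang_length1 mp qZ oq (ltnW m2) eq)) => //.
  by nat_lia.
have oq' : off_path u m q'.
  move=> j jm E; rewrite E in eqq.
  by have E' := hang1 mp qZ oq jm (ltnW m2) eqq eq; rewrite E E' eqxx in q'2.
have rq' : rich q'.
  apply: (@rich_leaf _ q) => r rZ er; apply/eqP/negPn/negP => nr.
  have [or|[j jm rj]] := on_or_off u m r; last first.
    rewrite rj in er.
    exact: (hang_cycle mp qZ q'Z oq oq' eqq (ltnW m2) jm eq er).
  rewrite e_sym in er; rewrite e_sym in eqq.
  have := mx _ _ _ (hang_length3 mp qZ q'Z rZ oq oq' or nr (ltnW m2) er eqq eq).
  by nat_lia.
have m2' : 0 + 2 <= m by nat_lia.
have hq : lpath e [set q; q'] q q' 1.
  by apply: lpath_edge; rewrite ?inE ?eqxx ?orbT //; apply: edge_neq eqq.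
have dq := pair_disjoint oq oq' m2'; rewrite disjoint_sym in dq; rewrite e_sym in eq.
have h := lpath_cat (mp_sub mp m2') hq dq eq.
apply: (rich_even_path (uZ 0 (leq0n m)) q'Z (rich_start mp) rq' (lpath_sub h _)) => //.
by rewrite !subUset !set1Z ?(mp_arcZ mp).
Qed.

(** Otherwise [m >= 3], and [u 1], [u 2] have degree 2 in the forest, so each has a neighbour on
    [Z]. One of the two neighbours of [u 0] differs from that of [u 2], and [local_path] applies. *)
Lemma maxpath_le1 u m : maxpath u m -> m <= 1.
Proof.
move=> mp; rewrite leqNgt; apply/negP => m1; have [uZ ue ui mx] := mp.
have om := maxpath_odd mp (ltnW m1).
have m2 : 2 < m by case: m m1 om {mp uZ ue ui mx} => [|[|[|]]].
have [a [b [an bn ab ea eb]]] := rich_start mp.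
have [c cn ec] := attached_degree2 (fun q qZ => second_vertex mp m1 qZ).
have [d dn ed] := attached_degree2 (fun q qZ => third_vertex mp m2 qZ).
have u02 : u 0 != u 2.
  by apply/eqP => /(ui 0 2 (leq0n m) (ltnW m2)).
have no f : f < N -> e (u 0) (z f) -> f != d -> False.
  move=> fn ef fd.
  exact: (local_path (uZ 0 (leq0n m)) (uZ 1 (ltnW m1)) (uZ 2 (ltnW m2))
    (ue 0 (ltnW m1)) (ue 1 m1) u02 fn cn dn fd ef ec ed).
have [ad|] := eqVneq a d; last exact: no.
by apply: (no b) => //; rewrite -ad eq_sym.
Qed.

(** A chord of the shortest odd cycle would split off a shorter odd cycle, so a third neighbour of
    [z 0] lies outside. *)
Lemma off_vertex_ex : exists y, y \notin Z.
Proof.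
have [y ey [yZ|[d [d1 dn yd]]]] := off_cycle_or_chord e_irr no_2cut order_ge6 0 hz.
  by exists y.
rewrite yd in ey; have [h1 h2] := chord_cycles e_sym order_ge6 hz d1 dn ey.
have := z_short h1; have := z_short h2; rewrite /= oddB ?(ltnW (ltnW dn)) // oN.
by case: (odd d) => /= [/(_ isT)|_ /(_ isT)]; nat_lia.
Qed.

(** * Off-cycle vertices spanning at most a matching *)

Lemma card_nbrs_pair x y : 2 < #|nbrs e [set x; y]|.
Proof.
apply: (card_nbrs_small no_2cut order_ge6).
  by apply/set0Pn; exists x; rewrite !inE eqxx.
by rewrite cards2; case: (_ != _).
Qed.

Lemma other_index a b : N = 3 -> a < N -> b < N ->
  exists c, [/\ c < N, c != a & c != b].
Proof.
move=> N3 an bn; have [n2 n1] : a < 3 /\ b < 3 by rewrite -N3.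
exists (if (a != 0) && (b != 0) then 0 else if (a != 1) && (b != 1) then 1 else 2).
rewrite N3; clear -n1 n2.
by case: a n2 => [|[|[|//]]] _; case: b n1 => [|[|[|//]]] _.
Qed.

Lemma uniq_off x a : x \notin Z -> (x == z a) = false.
Proof. by move=> xZ; apply: contraNF xZ => /eqP ->; apply: zZ. Qed.

Lemma four_cycle x y a b : N = 3 -> x \notin Z -> y \notin Z -> e x y ->
  a < N -> b < N -> a != b -> e x (z a) -> e y (z b) -> hascyc e setT 4.
Proof.
move=> N3 xZ yZ exy an bn ab ea eb; split=> //.
exists [:: x; y; z b; z a]; split=> //; last by move=> t; rewrite in_setT.
rewrite /ucycle /= !inE !negb_or ?(uniq_off _ xZ) ?(uniq_off _ yZ) (edge_neq e_irr exy) exy eb /=.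
by rewrite (e_sym (z a)) ea z_adj 1?eq_sym //= z_inj // eq_sym.
Qed.

Lemma six_cycle x y v a b c : N = 3 -> x \notin Z -> y \notin Z -> v \notin Z ->
  v != x -> v != y -> e x y -> a < N -> b < N -> c < N ->
  a != b -> b != c -> a != c ->
  e x (z a) -> e y (z b) -> e v (z b) -> e v (z c) -> hascyc e setT 6.
Proof.
move=> N3 xZ yZ vZ vx vy exy an bn cn ab bc ac ea eb evb evc; split=> //.
exists [:: x; y; z b; v; z c; z a]; split=> //; last by move=> t; rewrite in_setT.
have zoff a' t : t \notin Z -> (z a' == t) = false.
  by move=> tZ; rewrite eq_sym uniq_off.
rewrite /ucycle /= !inE !negb_or ?(uniq_off _ xZ) ?(uniq_off _ yZ) ?(uniq_off _ vZ).
rewrite ?(zoff _ _ vZ) (edge_neq e_irr exy) exy eb /=.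
rewrite (e_sym (z a)) ea (e_sym (z b)) evb evc (eq_sym x v) vx (eq_sym y v) vy.
by rewrite z_adj 1?eq_sym //= !z_inj // eq_sym.
Qed.

(** The order bound yields a further vertex [v], with neighbours [z c1], [z c2]. If [x] or [y] sees
    the third vertex [z c], the edge closes a 4-cycle with a side of the triangle, and replacing
    this side by a detour through [v] gives a 6-cycle. Otherwise the edge has only two
    neighbours. *)
Lemma no_edge_off x y : N = 3 -> x \notin Z -> y \notin Z -> e x y ->
  (forall v, v \notin Z -> rich v) ->
  (forall v, v \notin Z -> e x v -> v = y) ->
  (forall v, v \notin Z -> e y v -> v = x) -> False.
Proof.
move=> N3 xZ yZ exy allrich lx ly.
have [v [vZ vx vy]] : exists v, [/\ v \notin Z, v != x & v != y].
  have cZ : #|Z| = 3 by rewrite (card_cset hz).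
  have : 2 < #|~: Z| by have := cardsC Z; rewrite cZ; nat_lia.
  by move/(card_gt2_avoid x y) => [v]; rewrite in_setC => vZ [vx vy]; exists v.
have [c1 [c2 [c1n c2n c12 e1 e2]]] := allrich v vZ.
have [c [cn cc1 cc2]] := other_index N3 c1n c2n.
have main p q : p \notin Z -> q \notin Z -> v != p -> v != q -> e p q ->
    e p (z c) -> False.
  move=> pZ qZ vp vq epq ec.
  have [b [bn bc eb]] : exists b, [/\ b < N, b != c & e q (z b)].
    have [b1 [b2 [b1n b2n b12 eb1 eb2]]] := allrich q qZ.
    have [E|?] := eqVneq b1 c; last by exists b1.
    by exists b2; split=> //; rewrite -E eq_sym.
  have cb : c != b by rewrite eq_sym.
  have c4 := four_cycle N3 pZ qZ epq cn bn cb ec eb.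
  suff /(no_two_lengths _ c4) : hascyc e setT 6 by apply.
  have [E|ne] := eqVneq b c1.
    subst b.
    exact: (six_cycle N3 pZ qZ vZ vp vq epq cn c1n c2n cb c12 cc2 ec eb e1 e2).
  have E : b = c2 by clear -N3 bn c1n c2n cn c12 cc1 cc2 ne bc; lia.
  subst b; have c21 : c2 != c1 by rewrite eq_sym.
  exact: (six_cycle N3 pZ qZ vZ vp vq epq cn c2n c1n cb c21 cc1 ec eb e2 e1).
have NxyZ t : t \in nbrs e [set x; y] -> t \in Z.
  move=> /nbrsP[txy [s sxy est]]; apply: contraNT txy => tZ.
  move: sxy est; rewrite !inE => /orP[]/eqP -> est.
    by rewrite (lx t tZ est) eqxx orbT.
  by rewrite (ly t tZ est) eqxx.
have [cN|cN] := boolP (z c \in nbrs e [set x; y]).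
  have [_ [s]] := nbrsP _ _ _ cN; rewrite !inE => /orP[]/eqP -> es.
    exact: (main x y).
  by apply: (main y x) => //; rewrite e_sym.
have sub : nbrs e [set x; y] \subset Z :\ z c.
  apply/subsetP=> t tN; rewrite in_setD1 (NxyZ t tN) andbT.
  by apply: contraNneq cN => <-.
have cD : #|Z :\ z c| = 2.
  by have := cardsD1 (z c) Z; rewrite zZ (card_cset hz) N3 => -[].
have : 2 < #|nbrs e [set x; y]| by apply: (card_nbrs_pair x y).
by move/leq_trans => /(_ _ (subset_leq_card sub)); rewrite cD.
Qed.

(** [x] sees exactly two vertices of [Z]. Another neighbour of [y] would be their midpoint by
    [rich_edge], and then a second neighbour of [y], at distance 2 from it, has no possible place.
    So the edge has only two neighbours. *)
Lemma no_edge_off_long x y : 4 < N -> x \notin Z -> y \notin Z -> e x y ->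
  rich x -> rich y ->
  (forall v, v \notin Z -> e x v -> v = y) ->
  (forall v, v \notin Z -> e y v -> v = x) -> False.
Proof.
move=> N5 xZ yZ exy [a [b [an bn ab ea eb]]] [c [d [cn dn cd ec ed]]] lx ly.
have Dab := rich_dist xZ an bn ab ea eb.
have xab f : f < N -> e x (z f) -> f = a \/ f = b.
  move=> fn ef; have [->|fa] := eqVneq f a; first by left.
  have [->|fb] := eqVneq f b; [by right|exfalso].
  rewrite eq_sym in fa; rewrite eq_sym in fb.
  exact: (no_dist2_triple oN N5 an bn fn Dab (rich_dist xZ bn fn fb eb ef)
    (rich_dist xZ an fn fa ea ef)).
have yab f : f < N -> e y (z f) -> f = a \/ f = b.
  move=> fn ef; have [->|fa] := eqVneq f a; first by left.
  have [->|fb] := eqVneq f b; [by right|exfalso].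
  have mid h : h < N -> h != a -> h != b -> e y (z h) ->
      consecutive N a h /\ consecutive N b h.
    by move=> hn ha hb eh; apply: (rich_edge xZ yZ exy).
  have [af bf] := mid f fn fa fb ef.
  have [g [gn gf eg]] : exists g, [/\ g < N, f != g & e y (z g)].
    have [E|?] := eqVneq f c; last by exists c.
    by exists d; split=> //; rewrite E.
  have Dfg := rich_dist yZ fn gn gf ef eg.
  have [ga|ga] := eqVneq g a.
    by rewrite ga distC in Dfg; apply: (not_consecutive oN N5 an fn Dfg af).
  have [gb|gb] := eqVneq g b.
    by rewrite gb distC in Dfg; apply: (not_consecutive oN N5 bn fn Dfg bf).
  have [ag bg] := mid g gn ga gb eg.
  exact: (midpoint_uniq oN N_gt2 an bn fn gn Dab Dfg af bf ag bg).
have sub : nbrs e [set x; y] \subset [set z a; z b].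
  apply/subsetP=> t /nbrsP[txy [s sxy est]].
  have tZ : t \in Z.
    apply: contraNT txy => tZ; move: sxy est; rewrite !inE => /orP[]/eqP -> est.
      by rewrite (lx t tZ est) eqxx orbT.
    by rewrite (ly t tZ est) eqxx.
  have [f fn tf] := Z_P tZ; rewrite tf in est *.
  move: sxy est; rewrite !inE => /orP[]/eqP -> est.
    by case: (xab f fn est) => ->; rewrite eqxx ?orbT.
  by case: (yab f fn est) => ->; rewrite eqxx ?orbT.
have : 2 < #|nbrs e [set x; y]| by apply: (card_nbrs_pair x y).
move/leq_trans => /(_ _ (subset_leq_card sub)).
by rewrite cards2; case: (_ != _).
Qed.

(** Each vertex off [Z] has three neighbours on [Z], pairwise at distance 2, which is impossible for
    [4 < N]. A triangle and three vertices off it contain a [K_{3,3}], with cycles of lengths 4 and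
    6. *)
Lemma not_independent : (forall x y, x \notin Z -> y \notin Z -> ~~ e x y) -> False.
Proof.
move=> ind; have three x a b : x \notin Z ->
    exists f, [/\ f < N, f != a, f != b & e x (z f)].
  move=> xZ; have [y [ey ya yb]] := third_nbr no_2cut order_ge6 x (z a) (z b).
  have yZ : y \in Z by apply: contraTT ey => yZ; apply: ind.
  have [f fn yf] := Z_P yZ; rewrite yf in ey ya yb; exists f; split=> //.
    by apply: contraNneq ya => ->.
  by apply: contraNneq yb => ->.
have [N3|N3] := eqVneq N 3; last first.
  have N5 : 4 < N by nat_lia.
  have [x xZ] := off_vertex_ex.
  have [a [an _ _ ea]] := three x 0 0 xZ; have [b [bn ba _ eb]] := three x a a xZ.
  have [c [cn ca cb ec]] := three x a b xZ.
  rewrite eq_sym in ba; rewrite eq_sym in ca; rewrite eq_sym in cb.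
  exact: (no_dist2_triple oN N5 an bn cn (rich_dist xZ an bn ba ea eb)
    (rich_dist xZ bn cn cb eb ec) (rich_dist xZ an cn ca ea ec)).
have all x a : x \notin Z -> a < N -> e x (z a).
  move=> xZ an; have [b [bn ba]] : exists b, [/\ b < N & b != a].
    by have [b [? ? _]] := other_index N3 an an; exists b.
  have [c [cn ca cb]] := other_index N3 an bn.
  have [f [fn fb fc ef]] := three x b c xZ.
  suff -> : a = f by [].
  by clear -N3 an bn cn fn ba ca cb fb fc; lia.
have cZ : #|Z| = 3 by rewrite (card_cset hz).
have /card_gt2P[x [y [w [[xZ yZ wZ] [xy yw wx]]]]] : 2 < #|~: Z|.
  by have := cardsC Z; rewrite cZ; nat_lia.
rewrite !in_setC in xZ yZ wZ.
have zoff a' t : t \notin Z -> (z a' == t) = false.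
  by move=> tZ; rewrite eq_sym uniq_off.
have [n0 n1 n2] : [/\ 0 < N, 1 < N & 2 < N] by rewrite N3.
have nz a b : a < N -> b < N -> a != b -> (z a == z b) = false.
  by move=> an bn ab; apply/negbTE/z_inj.
apply: (@no_two_lengths 4 setT setT) => //; split=> //.
  exists [:: x; z 0; y; z 1]; split=> //; last by move=> t; rewrite in_setT.
  rewrite /ucycle /= !inE !negb_or ?(uniq_off _ xZ) ?(uniq_off _ yZ) ?(zoff _ _ yZ).
  rewrite xy (nz 0 1) //.
  by rewrite !(e_sym (z _)) !all.
exists [:: x; z 0; y; z 1; w; z 2]; split=> //; last by move=> t; rewrite in_setT.
rewrite /ucycle /= !inE !negb_or ?(uniq_off _ xZ) ?(uniq_off _ yZ) ?(uniq_off _ wZ).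
rewrite ?(zoff _ _ yZ) ?(zoff _ _ wZ) xy yw (eq_sym x w) wx.
by rewrite (nz 0 1) // (nz 0 2) // (nz 1 2) // !(e_sym (z _)) !all.
Qed.

Lemma shortest_odd_cycle_absurd : False.
Proof.
have [y0 y0Z] := off_vertex_ex.
have [|u [m [uZ' ue ui mx]]] := @longest_path_ex _ e (~: Z).
  by apply/set0Pn; exists y0; rewrite in_setC.
have mp : maxpath u m by split=> // k km; rewrite -in_setC; apply: uZ'.
have uZ k : k <= m -> u k \notin Z by case: mp => uZ _ _ _; apply: uZ.
have m1 := maxpath_le1 mp.
have edge1 x y : x \notin Z -> y \notin Z -> e x y -> 0 < m.
  move=> xZ yZ exy; apply: (mx x y).
  by apply: lpath_edge; rewrite ?in_setC //; apply: edge_neq exy.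
have [m0|m0] := posnP m.
  apply: not_independent => x y xZ yZ; apply/negP => exy.
  by have := edge1 x y xZ yZ exy; rewrite m0.
have {m1}m1 : m = 1 by nat_lia.
rewrite m1 in mp uZ ue mx.
(* A vertex with two neighbours off [Z] would be the middle of a path of length 2, longer than
   [m = 1]. *)
have allrich v : v \notin Z -> rich v.
  move=> vZ; have [[q [qZ eq]]|no] := classic (exists q, q \notin Z /\ e v q).
    apply: (@rich_leaf _ q) => r rZ er; apply/eqP/negPn/negP => rq.
    suff /mx : lpath e (~: Z) r q 2 by [].
    exists [:: v; q]; split=> //=.
    - by rewrite e_sym er eq.
    - by rewrite !inE negb_or rq (eq_sym r v) (edge_neq e_irr er) (edge_neq e_irr eq).
    - by move=> t; rewrite in_setC !in_cons orbF => /or3P[]/eqP ->.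
  by apply: (@rich_leaf _ v) => r rZ er; case: no; exists r.
have e01 := ue 0 isT; have Z0 := uZ 0 isT; have Z1 := uZ 1 isT.
have l0 v : v \notin Z -> e (u 0) v -> v = u 1 by apply: start_leaf mp v.
have l1 v : v \notin Z -> e (u 1) v -> v = u 0.
  exact: (start_leaf (maxpath_rev mp)).
have [N3|N3] := eqVneq N 3; first exact: (no_edge_off N3 Z0 Z1 e01 allrich l0 l1).
apply: (no_edge_off_long _ Z0 Z1 e01 (allrich _ Z0) (allrich _ Z1) l0 l1).
by nat_lia.
Qed.

End ShortestOddCycle.

(** * 3-connectivity and the conclusion *)

Lemma k_connected3_no_2cut (T : finType) (e : rel T) :
  k_connected 3 e -> has_no_2cut e.
Proof.
move=> [_ e_conn] X /set0Pn[x xX] N2; have [_ cN] := e_conn _ (N2 : #|_| < 3).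
apply/setP => y; rewrite in_setT; apply/negPn/negP.
rewrite in_setU negb_or => /andP[yX yN].
have xN : x \notin nbrs e X by apply/nbrsP => -[]; rewrite xX.
have /connectP[p pp py] : connect [rel u v in ~: nbrs e X | e u v] x y.
  by apply: cN; rewrite in_setC.
move/negP: yX; apply; rewrite py; clear yN py xN.
(* An edge that avoids [nbrs e X] cannot leave [X], so the whole path stays in [X]. *)
elim: p x xX pp => //= t p IH x xX /andP[/andP[/andP[_ tN] ext]].
apply: IH; apply: contraTT tN => tX; rewrite in_setC negbK.
by apply/nbrsP; split=> //; exists x.
Qed.

Theorem theorem6 (T : finType) (e : rel T)
    (e_sym : symmetric e) (e_irr : irreflexive e)
    (e_3conn : k_connected 3 e) (order_ge6 : 6 <= #|T|) :
  exists m : nat,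
    2 <= m /\ has_cycle_of_length e (2 * m) /\ has_cycle_of_length e (2 * m + 2).
Proof.
have no_2cut := k_connected3_no_2cut e_3conn.
apply: NNPP => no.
have no_win : ~ has_consecutive_even_cycles e.
  move=> [n [on [n2 [c [uc sc _]]] [_ [d [ud sd _]]]]]; apply: no; exists n./2.
  have -> : 2 * n./2 = n by lia.
  split; first by lia.
  rewrite addn2; split; first by split=> //; exists c.
  by split; [exact: leqW (leqW n2) | exists d].
have [n0 on0 hn0] := odd_cycle_ex e_sym e_irr no_2cut order_ge6 no_win.
have [|N [[oN hN] Nmin]] := @ex_min (fun n => odd n /\ hascyc e setT n).
  by exists n0.
have [z hz _] := (hascyc_fun _ _ _).1 hN.
apply: (shortest_odd_cycle_absurd e_sym e_irr no_2cut order_ge6 no_win hz oN).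
move=> A n hA on; apply: Nmin; split=> //; exact: hascyc_sub hA (subsetT _).
Qed.
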